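(* Let $r\ge 1$, $s\ge 0$ be integers, let $\alpha_1,\ldots,\alpha_r\in\mathbb{C}$ with $\alpha_1\notin\mathbb{Z}_{\le 0}$, let $\beta_1,\ldots,\beta_s\in\mathbb{C}\setminus\mathbb{Z}_{\le 0}$, and let $x\ge 0$. Suppose that either $\Re(p)>0$, or $p=0$, $x=0$ and $\Re(\alpha_1)>0$. Then for every $z\in\mathbb{C}$ for which the series defining the left-hand side converges, $$ {}_{r}\Gamma_{s}\left[\begin{array}{r}(\alpha_{1},x;p),\alpha_{2},\ldots,\alpha_{r};\\ \beta_{1},\ldots,\beta_{s};\end{array} z\right]=\frac{1}{\Gamma(\alpha_{1})}\int_{x}^{\infty}t^{\alpha_{1}-1}\,e^{-t-\frac{p}{t}}\;{}_{r-1}F_{s}\left[\begin{array}{r}\alpha_{2},\ldots,\alpha_{r};\\ \beta_{1},\ldots,\beta_{s};\end{array} zt\right]dt .$$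
   Context: Generalized incomplete Gamma function: $\Gamma(\nu,x;p):=\int_x^\infty t^{\nu-1}e^{-t-p/t}\,dt$ for $x\ge 0$ and $\Re(p)>0$ (also for $p=0$ whenever the integral converges). Extended incomplete Pochhammer symbol: $[\lambda;x,p]_\nu:=\Gamma(\lambda+\nu,x;p)/\Gamma(\lambda)$. Ordinary Pochhammer symbol: $(\lambda)_0=1$, $(\lambda)_n=\lambda(\lambda+1)\cdots(\lambda+n-1)$. Extended incomplete generalized hypergeometric function (when the series converges): $${}_{r}\Gamma_{s}\left[\begin{array}{r}(\alpha_{1},x;p),\alpha_{2},\ldots,\alpha_{r};\\ \beta_{1},\ldots,\beta_{s};\end{array} z\right]:=\sum_{n=0}^{\infty}\frac{[\alpha_{1};x,p]_{n}(\alpha_{2})_{n}\cdots(\alpha_{r})_{n}}{(\beta_{1})_{n}\cdots(\beta_{s})_{n}}\frac{z^{n}}{n!}.$$ ${}_{r-1}F_s$ is the ordinary generalized hypergeometric series $\sum_{n\ge0}\frac{(\alpha_2)_n\cdots(\alpha_r)_n}{(\beta_1)_n\cdots(\beta_s)_n}\frac{w^n}{n!}$ at argument $w=zt$. Integrals over unbounded intervals are understood as improper integrals. *)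

(* Defs.v *)
From Stdlib Require Import Reals Arith List.
From Coquelicot Require Import Coquelicot.
Open Scope C_scope.

Definition Cexp (z : C) : C :=
  (exp (Re z) * cos (Im z), exp (Re z) * sin (Im z))%R.

(* Principal value of t^a; meaningful for t > 0. *)
Definition Rcpow (t : R) (a : C) : C := Cexp (a * ln t).

(* The improper integral of f over (x, +oo) is taken at both ends, so that a
   singularity of the integrand at x = 0 is allowed and the value at x is never
   used. *)
Definition ex_improper (f : R -> C) (x : R) : Prop :=
  @ex_RInt_gen C_R_NormedModule f (at_right x) (Rbar_locally p_infty).

Definition improper (f : R -> C) (x : R) : C :=
  @RInt_gen C_R_CompleteNormedModule f (at_right x) (Rbar_locally p_infty).

Definition ex_Cseries (a : nat -> C) : Prop := @ex_series R_AbsRing C_R_NormedModule a.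

Definition Cseries (a : nat -> C) : C :=
  iota (T := C_R_CompleteNormedModule)
    (@is_series R_AbsRing C_R_NormedModule a).

Definition Gamma_inc (nu : C) (x : R) (p : C) : C :=
  improper (fun t => Rcpow t (nu - 1) * Cexp (- t - p / t)) x.

Fixpoint Poch (a : C) (n : nat) : C :=
  match n with
  | O => 1
  | S m => Poch a m * (a + INR m)
  end.

(* Euler's integral where Re nu > 0, continued to the other nu outside
   {0, -1, -2, ...} by Gamma (nu + 1) = nu * Gamma nu; the shift N is 0 when
   Re nu > 0, and Re (nu + N) > 0 always. *)
Definition Gamma (nu : C) : C :=
  let N := Z.to_nat (up (- Re nu)) in
  Gamma_inc (nu + INR N) 0 0 / Poch nu N.

Definition Poch_inc (a : C) (x : R) (p : C) (n : nat) : C :=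
  Gamma_inc (a + INR n) x p / Gamma a.

Definition Poch_prod (l : list C) (n : nat) : C :=
  fold_right (fun a w => Poch a n * w) 1 l.

Definition pFq_term (alpha beta : list C) (w : C) (n : nat) : C :=
  Poch_prod alpha n / Poch_prod beta n * (w ^ n / INR (fact n)).

Definition pFq (alpha beta : list C) (w : C) : C :=
  Cseries (pFq_term alpha beta w).

(* alpha lists the parameters following the first numerator parameter a. *)
Definition rGammas_term (a : C) (x : R) (p : C) (alpha beta : list C) (z : C)
    (n : nat) : C :=
  Poch_inc a x p n * Poch_prod alpha n / Poch_prod beta n
    * (z ^ n / INR (fact n)).

Definition rGammas (a : C) (x : R) (p : C) (alpha beta : list C) (z : C) : C :=
  Cseries (rGammas_term a x p alpha beta z).

(* Main.v *)
Require Import Defs.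
From Stdlib Require Import Reals List Lra Lia Factorial FunctionalExtensionality.
From Coquelicot Require Import Coquelicot.
Open Scope R_scope.

(** Write [d n] for the coefficients of the hypergeometric series, [w t = t^(a-1) exp(-t-p/t)] and
    [g n = Gamma_inc (a + n) x p], the integral of [t^n w t] over [(x, oo)]. The identity is the
    interchange of sum and integral, [sum (d n * g n)] being possibly only conditionally
    convergent, so it is obtained as in the proof that Borel's integral method is regular: with
    [phi n] the integral of [t^n w t] over [(u, v)] divided by [g n], one has
    [sum (d n * int_u^v t^n w t dt) = sum (d n * g n * phi n)], where [phi n -> 1] as [(u, v)]
    exhausts [(x, oo)], and Abel summation gives the limit as soon as [n |-> phi n] has bounded
    variation uniformly in [u, v]. Integration by parts expresses [phi n - phi (n + 1)] through
    [phi n - phi (n - 1)], with a small factor, and boundary terms [t^(a+n) exp(-t-p/t) / g (n + 1)]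
    whose sum over [n] is bounded in [t]. For complex [a] and [p] this needs
    [|g n| >= R n / 2] for large [n], [R n] being [g n] with [a], [p] replaced by their real
    parts: the phase of the integrand is nearly constant where its modulus is large. The same
    bound shows that [Gamma] has no zeros and that [d n] decays faster than geometrically. *)

(** * Limits and summation in C *)

Lemma C_norm_Cmod (z : C) : @norm _ C_R_NormedModule z = Cmod z.
Proof.
  change (sqrt (Rabs (fst z) ^ 2 + Rabs (snd z) ^ 2) = Cmod z).
  unfold Cmod. now rewrite !pow2_abs.
Qed.

Lemma C_ball_of_Cmod (a b : C) (e : R) :
  Cmod (b - a)%C < e -> @ball C_R_NormedModule a e b.
Proof.
  intros H. apply (@norm_compat1 _ C_R_NormedModule). rewrite C_norm_Cmod. exact H.
Qed.

(** Balls of the product structure are squares in the plane, so the modulus can exceed the radius by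
    [sqrt 2]; the factor 2 is a convenient upper bound for it. *)
Lemma Cmod_of_C_ball (a b : C) (e : R) :
  @ball C_R_NormedModule a e b -> Cmod (b - a)%C < 2 * e.
Proof.
  intros [H1 H2]. change (Rabs (fst b - fst a) < e) in H1.
  change (Rabs (snd b - snd a) < e) in H2.
  eapply Rle_lt_trans. apply Cmod_2Rmax.
  assert (Hm : Rmax (Rabs (fst (b - a)%C)) (Rabs (snd (b - a)%C)) < e)
    by (apply Rmax_lub_lt; assumption).
  assert (H0 : 0 <= Rmax (Rabs (fst (b - a)%C)) (Rabs (snd (b - a)%C))).
  { eapply Rle_trans; [|apply Rmax_l]. apply Rabs_pos. }
  assert (Hs : sqrt 2 <= 2).
  { rewrite <- (sqrt_pow2 2) at 2 by lra. apply sqrt_le_1; lra. }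
  apply Rle_lt_trans with (2 * Rmax (Rabs (fst (b - a)%C)) (Rabs (snd (b - a)%C))).
  - now apply Rmult_le_compat_r.
  - lra.
Qed.

(** Convergence is phrased with [Cmod], so that the triangle inequality applies directly, and along
    an arbitrary filter, so that the same rules serve partial sums ([eventually]) and truncated
    integrals ([cut x]). *)
Definition Clim {T : Type} (F : (T -> Prop) -> Prop) (f : T -> C) (l : C) : Prop :=
  forall eps, 0 < eps -> F (fun t => Cmod (f t - l)%C < eps).

Lemma Clim_iff {T} (F : (T -> Prop) -> Prop) {FF : Filter F} (f : T -> C) (l : C) :
  Clim F f l <-> filterlim f F (@locally C_R_NormedModule l).
Proof.
  split.
  - intros H. apply (proj2 (@filterlim_locally _ C_R_NormedModule F FF f l)).
    intros eps. apply filter_imp with (2 := H eps (cond_pos eps)).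
    intros t. apply C_ball_of_Cmod.
  - intros H eps He.
    assert (He2 : 0 < eps / 2) by lra.
    generalize (proj1 (@filterlim_locally _ C_R_NormedModule F FF f l) H (mkposreal _ He2)).
    apply filter_imp. intros t Ht. apply Cmod_of_C_ball in Ht. simpl in Ht. lra.
Qed.

Lemma Clim_ext {T} (F : (T -> Prop) -> Prop) {FF : Filter F} (f g : T -> C) (l : C) :
  F (fun t => f t = g t) -> Clim F f l -> Clim F g l.
Proof.
  intros H Hf e He. generalize (filter_and _ _ H (Hf e He)). apply filter_imp.
  now intros t [<- Ht].
Qed.

Lemma Clim_const {T} (F : (T -> Prop) -> Prop) {FF : Filter F} (l : C) :
  Clim F (fun _ => l) l.
Proof.
  intros e He. apply filter_forall. intros _. replace (l - l)%C with (RtoC 0) by ring.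
  now rewrite Cmod_0.
Qed.

Lemma Clim_plus {T} (F : (T -> Prop) -> Prop) {FF : Filter F} (f g : T -> C) (l m : C) :
  Clim F f l -> Clim F g m -> Clim F (fun t => f t + g t)%C (l + m)%C.
Proof.
  intros Hf Hg e He. assert (He2 : 0 < e / 2) by lra.
  generalize (filter_and _ _ (Hf _ He2) (Hg _ He2)). apply filter_imp.
  intros t [H1 H2]. replace (f t + g t - (l + m))%C with ((f t - l) + (g t - m))%C by ring.
  eapply Rle_lt_trans; [apply Cmod_triangle|]. lra.
Qed.

Lemma Clim_scal {T} (F : (T -> Prop) -> Prop) {FF : Filter F} (c : C) (f : T -> C) (l : C) :
  Clim F f l -> Clim F (fun t => c * f t)%C (c * l)%C.
Proof.
  intros Hf e He. pose proof (Cmod_ge_0 c).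
  assert (He2 : 0 < e / (Cmod c + 1)) by (apply Rdiv_lt_0_compat; lra).
  generalize (Hf _ He2). apply filter_imp.
  intros t H1. replace (c * f t - c * l)%C with (c * (f t - l))%C by ring.
  rewrite Cmod_mult. pose proof (Cmod_ge_0 (f t - l)%C).
  assert (He3 : (Cmod c + 1) * (e / (Cmod c + 1)) = e) by (field; lra).
  nra.
Qed.

Lemma Clim_minus {T} (F : (T -> Prop) -> Prop) {FF : Filter F} (f g : T -> C) (l m : C) :
  Clim F f l -> Clim F g m -> Clim F (fun t => f t - g t)%C (l - m)%C.
Proof.
  intros Hf Hg. apply (Clim_ext F) with (fun t => f t + (-(1))%R * g t)%C.
  - apply filter_forall. intros t. rewrite RtoC_opp. ring.
  - replace (l - m)%C with (l + (-(1))%R * m)%C by (rewrite RtoC_opp; ring).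
    apply (Clim_plus F); auto. now apply (Clim_scal F).
Qed.

Lemma Clim_unique {T} (F : (T -> Prop) -> Prop) {FF : ProperFilter F} (f : T -> C) (l m : C) :
  Clim F f l -> Clim F f m -> l = m.
Proof.
  intros Hf Hg. apply (@filterlim_locally_unique _ _ C_R_NormedModule F _ f).
  now apply (Clim_iff F). now apply (Clim_iff F).
Qed.

Lemma Cmod_sym (a b : C) : Cmod (a - b)%C = Cmod (b - a)%C.
Proof. rewrite <- Cmod_opp. f_equal. ring. Qed.

Lemma Cmod_le_dist (a b : C) : Cmod a <= Cmod b + Cmod (a - b)%C.
Proof.
  replace a with (b + (a - b))%C at 1 by ring. apply Cmod_triangle.
Qed.

Lemma Clim_Cmod {T} (F : (T -> Prop) -> Prop) {FF : Filter F} (f : T -> C) (l : C) :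
  Clim F f l -> Clim F (fun t => RtoC (Cmod (f t))) (RtoC (Cmod l)).
Proof.
  intros Hf e He. generalize (Hf e He). apply filter_imp. intros t Ht.
  rewrite <- RtoC_minus, Cmod_R. apply Rle_lt_trans with (2 := Ht).
  apply Rabs_le. generalize (Cmod_le_dist (f t) l) (Cmod_le_dist l (f t)).
  rewrite (Cmod_sym l). lra.
Qed.

Lemma Clim_le {T} (F : (T -> Prop) -> Prop) {FF : ProperFilter F} (f g : T -> R) (l m : R) :
  F (fun t => f t <= g t) -> Clim F (fun t => RtoC (f t)) l ->
  Clim F (fun t => RtoC (g t)) m -> l <= m.
Proof.
  intros H Hf Hg. apply Rnot_lt_le. intros Hlt.
  assert (He : 0 < (l - m) / 2) by lra.
  destruct (filter_ex _ (filter_and _ _ H (filter_and _ _ (Hf _ He) (Hg _ He))))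
    as [t [H1 [H2 H3]]].
  rewrite <- RtoC_minus, Cmod_R in H2, H3.
  apply Rabs_def2 in H2. apply Rabs_def2 in H3. lra.
Qed.

Lemma Clim_Cmod_le {T} (F : (T -> Prop) -> Prop) {FF : ProperFilter F} (f : T -> C) (l : C) (B : R) :
  F (fun t => Cmod (f t) <= B) -> Clim F f l -> Cmod l <= B.
Proof.
  intros H Hf. apply (Clim_le F (fun t => Cmod (f t)) (fun _ => B)); auto.
  now apply (Clim_Cmod F). apply (Clim_const F).
Qed.

Lemma Clim_cauchy {T} (F : (T -> Prop) -> Prop) {FF : ProperFilter F} (f : T -> C) :
  (forall eps, 0 < eps -> exists P : T -> Prop, F P /\
     forall u v, P u -> P v -> Cmod (f u - f v)%C < eps) -> exists l, Clim F f l.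
Proof.
  intros H.
  destruct (proj1 (@filterlim_locally_cauchy T C_R_CompleteNormedModule F FF f)) as [l Hl].
  - intros eps. destruct (H eps (cond_pos eps)) as [P [HP Hc]].
    exists P. split; auto. intros u v Hu Hv.
    apply C_ball_of_Cmod. now apply Hc.
  - exists l. now apply (Clim_iff F).
Qed.

(** * Finite sums and convergent series. [Csum a n] has the [n] terms of index below [n], whereas
    [sum_n a n] includes index [n] *)

Fixpoint Csum (a : nat -> C) (n : nat) : C :=
  match n with
  | O => 0
  | S m => Csum a m + a m
  end%C.

Lemma Csum_ext (a b : nat -> C) (n : nat) :
  (forall k, (k < n)%nat -> a k = b k) -> Csum a n = Csum b n.
Proof.
  induction n; simpl; intros H; auto. rewrite IHn, H; auto.
Qed.

Lemma Csum_scal (c : C) (a : nat -> C) (n : nat) :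
  Csum (fun k => c * a k)%C n = (c * Csum a n)%C.
Proof. induction n; simpl; [ring|rewrite IHn; ring]. Qed.

Lemma Csum_split (a : nat -> C) (m n : nat) :
  Csum a (m + n) = (Csum a m + Csum (fun k => a (m + k)%nat) n)%C.
Proof.
  induction n; simpl. rewrite Nat.add_0_r; ring.
  rewrite Nat.add_succ_r. simpl. rewrite IHn. ring.
Qed.

Fixpoint Rsum (a : nat -> R) (n : nat) : R :=
  match n with
  | O => 0
  | S m => Rsum a m + a m
  end.

Lemma Rsum_le (a b : nat -> R) (n : nat) :
  (forall k, (k < n)%nat -> a k <= b k) -> Rsum a n <= Rsum b n.
Proof.
  induction n; simpl; intros H. lra.
  generalize (H n (Nat.lt_succ_diag_r n)). assert (Rsum a n <= Rsum b n) by auto. lra.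
Qed.

Lemma Rsum_lin (c d : R) (a b : nat -> R) (n : nat) :
  Rsum (fun k => c * a k + d * b k) n = c * Rsum a n + d * Rsum b n.
Proof. induction n; simpl; [ring|rewrite IHn; ring]. Qed.

Lemma Rsum_nonneg (a : nat -> R) (n : nat) : (forall k, 0 <= a k) -> 0 <= Rsum a n.
Proof. intros H; induction n; simpl; [lra|generalize (H n); lra]. Qed.

Lemma Rsum_shift_le (a : nat -> R) (m n : nat) : (forall k, 0 <= a k) ->
  Rsum (fun k => a (m + k)%nat) n <= Rsum a (m + n).
Proof.
  intros Ha. induction n; simpl.
  - now apply Rsum_nonneg.
  - rewrite Nat.add_succ_r. simpl. lra.
Qed.

Lemma Cmod_Csum_le (a : nat -> C) (n : nat) : Cmod (Csum a n) <= Rsum (fun k => Cmod (a k)) n.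
Proof.
  induction n; simpl. rewrite Cmod_0; lra.
  eapply Rle_trans; [apply Cmod_triangle|]. lra.
Qed.

Lemma Clim_Csum {T} (F : (T -> Prop) -> Prop) {FF : Filter F} (f : nat -> T -> C)
    (l : nat -> C) (n : nat) :
  (forall k, (k < n)%nat -> Clim F (f k) (l k)) ->
  Clim F (fun t => Csum (fun k => f k t) n) (Csum l n).
Proof.
  induction n; simpl; intros H. now apply (Clim_const F).
  apply (Clim_plus F); auto.
Qed.

Definition Csums (a : nat -> C) (l : C) : Prop := Clim eventually (Csum a) l.

Lemma sum_n_Csum (a : nat -> C) (n : nat) :
  @sum_n C_R_NormedModule a n = Csum a (S n).
Proof.
  induction n. rewrite sum_O. simpl. ring.
  rewrite sum_Sn, IHn. reflexivity.
Qed.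

Lemma is_series_Csums (a : nat -> C) (l : C) :
  @is_series R_AbsRing C_R_NormedModule a l <-> Csums a l.
Proof.
  unfold is_series. rewrite <- (Clim_iff eventually).
  split; intros H e He; destruct (H e He) as [N HN].
  - exists (S N). intros [|n] Hn; [lia|]. rewrite <- sum_n_Csum. apply HN. lia.
  - exists N. intros n Hn. rewrite sum_n_Csum. apply HN. lia.
Qed.

Lemma Cseries_unique (a : nat -> C) (l : C) : Csums a l -> Cseries a = l.
Proof.
  intros H. unfold Cseries.
  apply (@iota_filterlim_locally _ C_R_CompleteNormedModule _ eventually _
    (@sum_n C_R_NormedModule a)).
  now apply is_series_Csums.
Qed.

Lemma Csums_tail (b : nat -> C) (B : C) (eps : R) : Csums b B -> 0 < eps ->
  exists M, forall m k, (M <= m)%nat -> Cmod (Csum (fun j => b (m + j)%nat) k) <= eps /\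
    Cmod (B - Csum b m)%C <= eps.
Proof.
  intros H He. assert (He2 : 0 < eps / 2) by lra.
  destruct (H _ He2) as [M HM]. exists M. intros m k Hm.
  pose proof (HM m Hm) as H1. assert (H2 := HM (m + k)%nat ltac:(lia)).
  rewrite Csum_split in H2. split.
  - set (S1 := Csum _ k) in *.
    replace S1 with ((Csum b m + S1 - B) + (B - Csum b m))%C by ring.
    eapply Rle_trans; [apply Cmod_triangle|]. rewrite (Cmod_sym B). lra.
  - rewrite Cmod_sym. lra.
Qed.

(** * Abel summation and regularity of a summation method *)

Lemma abel_bound (b phi : nat -> C) (eps K : R) (n : nat) : 0 <= eps ->
  (forall k, Cmod (Csum b k) <= eps) -> (forall k, Cmod (phi k) <= K) ->
  Rsum (fun k => Cmod (phi k - phi (S k))%C) n <= K ->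
  Cmod (Csum (fun k => b k * phi k)%C n) <= 2 * K * eps.
Proof.
  intros He Hb Hp Hv.
  (* Summation by parts moves the differences onto [phi]; the boundary term and the remaining sum
     each cost at most [K * eps]. *)
  assert (Hid : Csum (fun k => b k * phi k)%C n =
    (Csum b n * phi n + Csum (fun k => Csum b (S k) * (phi k - phi (S k)))%C n)%C).
  { clear. induction n; cbn [Csum]. ring. rewrite IHn. cbn [Csum]. ring. }
  rewrite Hid. eapply Rle_trans; [apply Cmod_triangle|].
  assert (H1 : Cmod (Csum b n * phi n)%C <= K * eps).
  { rewrite Cmod_mult. rewrite Rmult_comm.
    apply Rmult_le_compat; auto using Cmod_ge_0. }
  assert (H2 : Cmod (Csum (fun k => Csum b (S k) * (phi k - phi (S k)))%C n) <= K * eps).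
  { eapply Rle_trans; [apply Cmod_Csum_le|].
    apply Rle_trans with (Rsum (fun k => eps * Cmod (phi k - phi (S k))%C + 0 * 0) n).
    - apply Rsum_le. intros k _. rewrite Cmod_mult.
      generalize (Rmult_le_compat_r _ _ _ (Cmod_ge_0 (phi k - phi (S k))%C) (Hb (S k))). lra.
    - rewrite (Rsum_lin eps 0 (fun k => Cmod (phi k - phi (S k))%C) (fun _ => 0)).
      generalize (Rmult_le_compat_l _ _ _ He Hv). lra. }
  lra.
Qed.

(** Abel summation makes the tails of the transformed series small uniformly in [t], using only
    convergence of the series of [b], not absolute convergence; the finitely many other terms
    converge one by one. The factorisation is asked only from [N] on because in the application the
    denominators of [phi] may vanish earlier. *)
Lemma toeplitz_regularity {T} (F : (T -> Prop) -> Prop) {FF : ProperFilter F}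
    (b : nat -> C) (B : C) (c phi : nat -> T -> C) (J : T -> C) (N : nat) (K : R) :
  Csums b B ->
  (forall n, Clim F (c n) (b n)) ->
  (forall n t, (N <= n)%nat -> c n t = (b n * phi n t)%C) ->
  F (fun t => Csums (fun n => c n t) (J t) /\
     (forall n, (N <= n)%nat -> Cmod (phi n t) <= K) /\
     forall m, Rsum (fun k => Cmod (phi (N + k)%nat t - phi (N + S k)%nat t)%C) m <= K) ->
  Clim F J B.
Proof.
  intros HB Hc Hcp HF e He.
  assert (HK : 0 <= K).
  { destruct (filter_ex _ HF) as [t [_ [H _]]].
    eapply Rle_trans; [apply (Cmod_ge_0 (phi N t))|]. now apply H. }
  assert (He2 : 0 < e / (4 * (K + 1))) by (apply Rdiv_lt_0_compat; lra).
  (* The tail of the transformed series, its initial segment and the tail of [b] contribute at most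
     [2 * K * e'], [e'] and [e'], together less than [e]. *)
  set (e' := e / (4 * (K + 1))) in *.
  assert (Hee : e' * (4 * (K + 1)) = e) by (unfold e'; field; lra).
  destruct (Csums_tail b B e' HB He2) as [M0 HM0].
  set (M := (N + M0)%nat).
  assert (HS : Clim F (fun t => Csum (fun n => c n t) M) (Csum b M)).
  { apply (Clim_Csum F). auto. }
  generalize (filter_and _ _ HF (HS e' He2)). apply filter_imp.
  intros t [[HJ [Hp Hv]] Ht].
  (* Blocks starting at [M] are bounded independently of their length, and the bound passes to the
     limit. *)
  assert (Htail : Cmod (J t - Csum (fun n => c n t) M)%C <= 2 * K * e').
  { apply (Clim_Cmod_le eventually (fun m => Csum (fun n => c n t) m - Csum (fun n => c n t) M)%C).
    - exists M. intros m Hm. replace m with (M + (m - M))%nat by lia.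
      rewrite Csum_split.
      match goal with |- Cmod (?a + ?s - ?a)%C <= _ => replace (a + s - a)%C with s by ring end.
      set (k := (m - M)%nat).
      rewrite (Csum_ext _ (fun k => b (M + k)%nat * phi (M + k)%nat t)%C).
      2: intros j _; apply Hcp; unfold M; lia.
      apply (abel_bound (fun k => b (M + k)%nat) (fun k => phi (M + k)%nat t)).
      + lra.
      + intros j. apply HM0. unfold M; lia.
      + intros j. apply Hp. unfold M; lia.
      + eapply Rle_trans; [|apply (Hv (M0 + k)%nat)].
        eapply Rle_trans; [|apply Rsum_shift_le; intros; apply Cmod_ge_0].
        apply Rsum_le. intros j _. unfold M.
        replace (N + M0 + j)%nat with (N + (M0 + j))%nat by lia.
        replace (N + M0 + S j)%nat with (N + S (M0 + j))%nat by lia. apply Rle_refl.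
    - apply (Clim_minus eventually); [exact HJ|apply (Clim_const eventually)]. }
  assert (HBt := proj2 (HM0 M O ltac:(unfold M; lia))).
  replace (J t - B)%C with ((J t - Csum (fun n => c n t) M) + ((Csum (fun n => c n t) M - Csum b M)
    + (Csum b M - B)))%C by ring.
  eapply Rle_lt_trans; [apply Cmod_triangle|].
  eapply Rle_lt_trans; [apply Rplus_le_compat_l, Cmod_triangle|].
  rewrite (Cmod_sym (Csum b M) B). nra.
Qed.

(** * The integrand and its improper integral *)

Definition CRInt (f : R -> C) (u v : R) (l : C) : Prop := @is_RInt C_R_NormedModule f u v l.

Lemma CRInt_iff (f : R -> C) (u v : R) (l : C) :
  CRInt f u v l <->
  is_RInt (fun t => fst (f t)) u v (fst l) /\ is_RInt (fun t => snd (f t)) u v (snd l).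
Proof.
  split.
  - intros H. split.
    + exact (@is_RInt_fct_extend_fst R_NormedModule R_NormedModule f u v l H).
    + exact (@is_RInt_fct_extend_snd R_NormedModule R_NormedModule f u v l H).
  - intros [H1 H2]. destruct l as [l1 l2].
    exact (@is_RInt_fct_extend_pair R_NormedModule R_NormedModule f u v l1 l2 H1 H2).
Qed.

Lemma CRInt_plus (f g : R -> C) (u v : R) (l m : C) :
  CRInt f u v l -> CRInt g u v m -> CRInt (fun t => f t + g t)%C u v (l + m)%C.
Proof. intros H1 H2. exact (@is_RInt_plus C_R_NormedModule f g u v l m H1 H2). Qed.

Lemma CRInt_mult (c : C) (f : R -> C) (u v : R) (l : C) :
  CRInt f u v l -> CRInt (fun t => c * f t)%C u v (c * l)%C.
Proof.
  intros H. apply CRInt_iff in H. destruct H as [H1 H2]. apply CRInt_iff. simpl. split.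
  - exact (@is_RInt_minus R_NormedModule _ _ u v _ _
      (@is_RInt_scal R_NormedModule _ u v (fst c) _ H1)
      (@is_RInt_scal R_NormedModule _ u v (snd c) _ H2)).
  - exact (@is_RInt_plus R_NormedModule _ _ u v _ _
      (@is_RInt_scal R_NormedModule _ u v (fst c) _ H2)
      (@is_RInt_scal R_NormedModule _ u v (snd c) _ H1)).
Qed.

Lemma CRInt_ext (f g : R -> C) (u v : R) (l : C) :
  (forall t, Rmin u v < t < Rmax u v -> f t = g t) -> CRInt f u v l -> CRInt g u v l.
Proof. intros H. exact (@is_RInt_ext C_R_NormedModule f g u v l H). Qed.

Lemma CRInt_unique (f : R -> C) (u v : R) (l m : C) :
  CRInt f u v l -> CRInt f u v m -> l = m.
Proof.
  intros H1 H2.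
  rewrite <- (@is_RInt_unique C_R_CompleteNormedModule f u v l H1).
  exact (@is_RInt_unique C_R_CompleteNormedModule f u v m H2).
Qed.

Lemma CRInt_Chasles (f : R -> C) (u v w : R) (l m : C) :
  CRInt f u v l -> CRInt f v w m -> CRInt f u w (l + m)%C.
Proof. exact (@is_RInt_Chasles C_R_NormedModule f u v w l m). Qed.

Lemma CRInt_Cmod_le (f : R -> C) (g : R -> R) (u v : R) (l : C) (m : R) :
  u <= v -> (forall t, u <= t <= v -> Cmod (f t) <= g t) ->
  CRInt f u v l -> is_RInt g u v m -> Cmod l <= m.
Proof.
  intros Huv H Hf Hg. rewrite <- C_norm_Cmod.
  apply (@norm_RInt_le C_R_NormedModule f g u v l m); auto.
  intros t Ht. rewrite C_norm_Cmod. auto.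
Qed.

Lemma CRInt_Cmod_le_const (f : R -> C) (u v : R) (l : C) (M : R) :
  (forall t, Rmin u v <= t <= Rmax u v -> Cmod (f t) <= M) ->
  CRInt f u v l -> Cmod l <= Rabs (v - u) * M.
Proof.
  intros H Hf. rewrite <- C_norm_Cmod.
  apply (@norm_RInt_le_const_abs C_R_NormedModule f u v l M); auto.
  intros t Ht. rewrite C_norm_Cmod. auto.
Qed.

(** * The integrand in polar form: [kern] is the modulus and [phase] the argument of [K] *)

Definition kern (q s t : R) : R := exp (s * ln t - t - q / t).

Definition phase (p nu : C) (t : R) : R := Im nu * ln t - Im p / t.

(** The exponent is [nu] itself, so that [Gamma_inc nu x p] is the integral of [K p (nu - 1)]; this
    shift by one recurs throughout. *)
Definition K (p nu : C) (t : R) : C := (Rcpow t nu * Cexp (- t - p / t))%C.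

Lemma Cexp_plus (a b : C) : Cexp (a + b)%C = (Cexp a * Cexp b)%C.
Proof.
  destruct a as [a1 a2], b as [b1 b2].
  unfold Cexp, Cmult, Re, Im; simpl. rewrite exp_plus, cos_plus, sin_plus.
  f_equal; ring.
Qed.

Lemma K_polar (p nu : C) (t : R) : t <> 0 ->
  K p nu t = (kern (Re p) (Re nu) t * cos (phase p nu t),
              kern (Re p) (Re nu) t * sin (phase p nu t)).
Proof.
  intros Ht. unfold K, Rcpow. rewrite <- Cexp_plus.
  assert (H1 : Re (nu * ln t + (- t - p / t))%C = Re nu * ln t - t - Re p / t).
  { destruct nu, p. unfold Re; simpl. field. auto. }
  assert (H2 : Im (nu * ln t + (- t - p / t))%C = Im nu * ln t - Im p / t).
  { destruct nu, p. unfold Im; simpl. field. auto. }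
  unfold Cexp. rewrite H1, H2. reflexivity.
Qed.

Lemma Cmod_K (p nu : C) (t : R) : t <> 0 -> Cmod (K p nu t) = kern (Re p) (Re nu) t.
Proof.
  intros Ht. rewrite K_polar by auto. unfold Cmod; simpl.
  replace (_ + _) with (kern (Re p) (Re nu) t * kern (Re p) (Re nu) t *
    (Rsqr (sin (phase p nu t)) + Rsqr (cos (phase p nu t)))) by (unfold Rsqr; ring).
  rewrite sin2_cos2, Rmult_1_r. apply sqrt_square. apply Rlt_le, exp_pos.
Qed.

Lemma K_mul_pow (p nu : C) (n : nat) (t : R) : 0 < t ->
  K p (nu + INR n)%C t = (K p nu t * t ^ n)%C.
Proof.
  intros Ht. unfold K, Rcpow.
  replace ((nu + INR n) * ln t)%C with (nu * ln t + INR n * ln t)%C by ring.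
  rewrite Cexp_plus.
  assert (H : Cexp (INR n * ln t)%C = (t ^ n)%C).
  { rewrite <- RtoC_mult, <- RtoC_pow. unfold Cexp. rewrite re_RtoC, im_RtoC, cos_0, sin_0.
    rewrite <- (Rpower_pow n t Ht). unfold Rpower, RtoC. f_equal; ring. }
  rewrite H. ring.
Qed.

Lemma kern_pos (q s t : R) : 0 < kern q s t.
Proof. apply exp_pos. Qed.

Lemma kern_succ (q s t : R) : 0 < t -> kern q (s + 1) t = t * kern q s t.
Proof.
  intros Ht. unfold kern. rewrite <- (exp_ln t Ht) at 4. rewrite <- exp_plus. f_equal. ring.
Qed.

Lemma kern_pow (q s : R) (n : nat) (t : R) : 0 < t -> kern q (s + INR n) t = t ^ n * kern q s t.
Proof.
  intros Ht. induction n. simpl. rewrite Rplus_0_r. ring.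
  rewrite S_INR, <- Rplus_assoc, kern_succ, IHn by auto. simpl. ring.
Qed.

Lemma is_derive_kern (q s t : R) : 0 < t ->
  is_derive (kern q s) t (kern q s t * (s / t - 1 + q / t ^ 2)).
Proof.
  intros Ht. unfold kern. auto_derive. repeat split; lra. unfold Rminus, Rdiv. set (E := exp _). field. lra.
Qed.

Lemma is_derive_phase (p nu : C) (t : R) : 0 < t ->
  is_derive (phase p nu) t (Im nu / t + Im p / t ^ 2).
Proof.
  intros Ht. unfold phase. auto_derive. repeat split; lra. field. lra.
Qed.

Lemma is_derive_K_re (p nu : C) (t : R) : 0 < t ->
  is_derive (fun t => kern (Re p) (Re nu) t * cos (phase p nu t)) t
    (kern (Re p) (Re nu) t * (Re nu / t - 1 + Re p / t ^ 2) * cos (phase p nu t) -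
     kern (Re p) (Re nu) t * sin (phase p nu t) * (Im nu / t + Im p / t ^ 2)).
Proof.
  intros Ht. pose proof (is_derive_kern (Re p) (Re nu) t Ht) as H1.
  pose proof (is_derive_phase p nu t Ht) as H2.
  set (a := kern (Re p) (Re nu)) in *. set (b := phase p nu) in *.
  auto_derive. split. eexists; exact H1. split; [eexists; exact H2|exact I].
  rewrite (is_derive_unique (fun t : R => a t) _ _ H1), (is_derive_unique (fun t : R => b t) _ _ H2). ring.
Qed.

Lemma is_derive_K_im (p nu : C) (t : R) : 0 < t ->
  is_derive (fun t => kern (Re p) (Re nu) t * sin (phase p nu t)) t
    (kern (Re p) (Re nu) t * (Re nu / t - 1 + Re p / t ^ 2) * sin (phase p nu t) +
     kern (Re p) (Re nu) t * cos (phase p nu t) * (Im nu / t + Im p / t ^ 2)).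
Proof.
  intros Ht. pose proof (is_derive_kern (Re p) (Re nu) t Ht) as H1.
  pose proof (is_derive_phase p nu t Ht) as H2.
  set (a := kern (Re p) (Re nu)) in *. set (b := phase p nu) in *.
  auto_derive. split. eexists; exact H1. split; [eexists; exact H2|exact I].
  rewrite (is_derive_unique (fun t : R => a t) _ _ H1), (is_derive_unique (fun t : R => b t) _ _ H2). ring.
Qed.

Lemma Rmin_pos_lt (u v t : R) : 0 < u -> 0 < v -> Rmin u v <= t -> 0 < t.
Proof. intros Hu Hv. unfold Rmin. destruct Rle_dec; lra. Qed.

Lemma ex_RInt_kern (q s u v : R) : 0 < u -> 0 < v -> ex_RInt (kern q s) u v.
Proof.
  intros Hu Hv. apply (@ex_RInt_continuous R_CompleteNormedModule). intros t [Ht _].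
  apply (ex_derive_continuous (K := R_AbsRing) (V := R_NormedModule)).
  eexists. apply is_derive_kern. exact (Rmin_pos_lt _ _ _ Hu Hv Ht).
Qed.

(** The endpoints form a pair so that [J p nu] is directly a function along the product filter
    [cut x]. *)
Definition J (p nu : C) (ab : R * R) : C :=
  @RInt C_R_CompleteNormedModule (K p nu) (fst ab) (snd ab).

Lemma J_spec (p nu : C) (u v : R) : 0 < u -> 0 < v -> CRInt (K p nu) u v (J p nu (u, v)).
Proof.
  intros Hu Hv. apply (@RInt_correct C_R_CompleteNormedModule).
  assert (H : exists l, CRInt (fun t => (kern (Re p) (Re nu) t * cos (phase p nu t),
              kern (Re p) (Re nu) t * sin (phase p nu t))) u v l).
  { assert (H1 : ex_RInt (fun t => kern (Re p) (Re nu) t * cos (phase p nu t)) u v).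
    { apply (@ex_RInt_continuous R_CompleteNormedModule). intros t [Ht _].
      apply (ex_derive_continuous (K := R_AbsRing) (V := R_NormedModule)).
      eexists. apply is_derive_K_re. exact (Rmin_pos_lt _ _ _ Hu Hv Ht). }
    assert (H2 : ex_RInt (fun t => kern (Re p) (Re nu) t * sin (phase p nu t)) u v).
    { apply (@ex_RInt_continuous R_CompleteNormedModule). intros t [Ht _].
      apply (ex_derive_continuous (K := R_AbsRing) (V := R_NormedModule)).
      eexists. apply is_derive_K_im. exact (Rmin_pos_lt _ _ _ Hu Hv Ht). }
    destruct H1 as [l1 H1], H2 as [l2 H2]. exists (l1, l2). apply CRInt_iff. now split. }
  destruct H as [l Hl]. exists l. apply CRInt_ext with (2 := Hl).
  intros t [Ht _]. rewrite K_polar; auto.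
  assert (0 < t) by (apply (Rmin_pos_lt u v); lra). lra.
Qed.

Lemma K_pred (p nu : C) (t : R) : 0 < t -> K p (nu - 1)%C t = ((/ t)%R * K p nu t)%C.
Proof.
  intros Ht. assert (H := K_mul_pow p (nu - 1) 1 t Ht).
  replace (nu - 1 + INR 1)%C with nu in H by (simpl; ring).
  rewrite H. simpl. rewrite RtoC_inv by lra. field. intros E. apply RtoC_inj in E. lra.
Qed.

Lemma K_pred2 (p nu : C) (t : R) : 0 < t -> K p (nu - 2)%C t = ((/ t ^ 2)%R * K p nu t)%C.
Proof.
  intros Ht. replace (nu - 2)%C with (nu - 1 - 1)%C by ring.
  rewrite !K_pred by auto. rewrite Cmult_assoc, <- RtoC_mult. do 2 f_equal. field. lra.
Qed.

(** The derivative of [K p nu] at [t] is [K p nu t] times [nu / t - 1 + p / t ^ 2], and each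
    division by [t] lowers the exponent by one. The fundamental theorem of calculus is applied to
    real and imaginary parts separately. *)
Lemma J_ftc (p nu : C) (u v : R) : 0 < u -> 0 < v ->
  (K p nu v - K p nu u = nu * J p (nu - 1) (u, v) - J p nu (u, v) + p * J p (nu - 2) (u, v))%C.
Proof.
  intros Hu Hv.
  set (f := fun t => (nu * K p (nu - 1) t + ((- (1))%R * K p nu t + p * K p (nu - 2) t))%C).
  apply (CRInt_unique f u v).
  - rewrite !K_polar by lra. apply CRInt_iff. split.
    + apply (@is_RInt_ext R_NormedModule) with (f := fun t =>
        kern (Re p) (Re nu) t * (Re nu / t - 1 + Re p / t ^ 2) * cos (phase p nu t) -
        kern (Re p) (Re nu) t * sin (phase p nu t) * (Im nu / t + Im p / t ^ 2)).
      * intros t [Ht _]. assert (0 < t) by (apply (Rmin_pos_lt u v); lra).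
        unfold f. rewrite K_pred, K_pred2, K_polar by lra.
        generalize (kern (Re p) (Re nu) t) (cos (phase p nu t)) (sin (phase p nu t)).
        intros a b c. destruct nu as [n1 n2], p as [p1 p2]. clear - H. simpl. field. lra.
      * apply (@is_RInt_derive R_CompleteNormedModule
          (fun t => kern (Re p) (Re nu) t * cos (phase p nu t))).
        intros t [Ht _]. apply is_derive_K_re. exact (Rmin_pos_lt _ _ _ Hu Hv Ht).
        intros t [Ht _]. assert (Ht0 : 0 < t) by (exact (Rmin_pos_lt _ _ _ Hu Hv Ht)).
        apply (ex_derive_continuous (K := R_AbsRing) (V := R_NormedModule)).
        auto_derive.
        pose proof (ex_intro _ _ (is_derive_kern (Re p) (Re nu) t Ht0) : ex_derive _ _) as H1.
        pose proof (ex_intro _ _ (is_derive_phase p nu t Ht0) : ex_derive _ _) as H2.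
        repeat split; auto; simpl; nra.
    + apply (@is_RInt_ext R_NormedModule) with (f := fun t =>
        kern (Re p) (Re nu) t * (Re nu / t - 1 + Re p / t ^ 2) * sin (phase p nu t) +
        kern (Re p) (Re nu) t * cos (phase p nu t) * (Im nu / t + Im p / t ^ 2)).
      * intros t [Ht _]. assert (0 < t) by (apply (Rmin_pos_lt u v); lra).
        unfold f. rewrite K_pred, K_pred2, K_polar by lra.
        generalize (kern (Re p) (Re nu) t) (cos (phase p nu t)) (sin (phase p nu t)).
        intros a b c. destruct nu as [n1 n2], p as [p1 p2]. clear - H. simpl. field. lra.
      * apply (@is_RInt_derive R_CompleteNormedModule
          (fun t => kern (Re p) (Re nu) t * sin (phase p nu t))).
        intros t [Ht _]. apply is_derive_K_im. exact (Rmin_pos_lt _ _ _ Hu Hv Ht).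
        intros t [Ht _]. assert (Ht0 : 0 < t) by (exact (Rmin_pos_lt _ _ _ Hu Hv Ht)).
        apply (ex_derive_continuous (K := R_AbsRing) (V := R_NormedModule)).
        auto_derive.
        pose proof (ex_intro _ _ (is_derive_kern (Re p) (Re nu) t Ht0) : ex_derive _ _) as H1.
        pose proof (ex_intro _ _ (is_derive_phase p nu t Ht0) : ex_derive _ _) as H2.
        repeat split; auto; simpl; nra.
  - replace (nu * J p (nu - 1) (u, v) - J p nu (u, v) + p * J p (nu - 2) (u, v))%C
      with (nu * J p (nu - 1) (u, v) + ((- (1))%R * J p nu (u, v) + p * J p (nu - 2) (u, v)))%C
      by (rewrite RtoC_opp; ring).
    unfold f. apply CRInt_plus; [|apply CRInt_plus];
      apply CRInt_mult, J_spec; assumption.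
Qed.

Definition Jr (q s : R) (ab : R * R) : R := RInt (kern q s) (fst ab) (snd ab).

Lemma Jr_spec (q s u v : R) : 0 < u -> 0 < v -> is_RInt (kern q s) u v (Jr q s (u, v)).
Proof. intros Hu Hv. apply (@RInt_correct R_CompleteNormedModule). now apply ex_RInt_kern. Qed.

Lemma K_real (q s t : R) : t <> 0 -> K q s t = RtoC (kern q s t).
Proof.
  intros Ht. rewrite K_polar by auto. unfold phase. rewrite !im_RtoC, !re_RtoC.
  replace (0 * ln t - 0 / t) with 0 by (field; auto). rewrite cos_0, sin_0.
  unfold RtoC. f_equal; ring.
Qed.

Lemma J_real (q s u v : R) : 0 < u -> 0 < v -> J q s (u, v) = RtoC (Jr q s (u, v)).
Proof.
  intros Hu Hv. apply (CRInt_unique (K q s) u v). now apply J_spec.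
  apply CRInt_ext with (f := fun t => RtoC (kern q s t)).
  - intros t [Ht _]. rewrite K_real; auto. assert (0 < t) by (apply (Rmin_pos_lt u v); lra). lra.
  - apply CRInt_iff. simpl. split. now apply Jr_spec.
    generalize (@is_RInt_const R_NormedModule u v 0).
    now rewrite (@scal_zero_r R_AbsRing R_NormedModule).
Qed.

Lemma J_le_Jr (p nu : C) (u v : R) : 0 < u <= v ->
  Cmod (J p nu (u, v)) <= Jr (Re p) (Re nu) (u, v).
Proof.
  intros H. apply (CRInt_Cmod_le (K p nu) (kern (Re p) (Re nu)) u v). lra.
  - intros t Ht. rewrite Cmod_K by lra. apply Rle_refl.
  - apply J_spec; lra.
  - apply Jr_spec; lra.
Qed.

Lemma ln_le_affine (r c : R) : 0 <= r -> 0 < c ->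
  exists B, forall y, 0 < y -> r * ln y <= c * y + B.
Proof.
  intros Hr Hc. set (d := c / (r + 1)).
  assert (Hd : 0 < d) by (apply Rdiv_lt_0_compat; lra).
  exists (- r * ln d). intros y Hy.
  assert (H := exp_ineq1_le (ln (d * y))). rewrite exp_ln in H by nra.
  rewrite ln_mult in H by auto.
  assert (Hrd : r * d <= c).
  { unfold d. apply (Rmult_le_reg_r (r + 1)). lra. field_simplify; nra. }
  nra.
Qed.

(** The condition for [kern q e] to be bounded near 0. It is stronger than integrability: [q = 0]
    with [-1 < e < 0] is excluded here and treated by integration by parts in
    [Gamma_inc_lim_low]. *)
Definition dom (q e : R) : Prop := 0 <= q /\ (0 < q \/ 0 <= e).

Lemma dom_mono (q e e' : R) : dom q e -> e <= e' -> dom q e'.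
Proof. intros [H [H1|H1]] He; split; auto. right; lra. Qed.

(** For [0 <= e] half of the exponential decay absorbs the power of [t]; for [e < 0] the factor
    [exp (- q / t)] does, by the affine bound on the logarithm taken at [/ t]. *)
Lemma kern_le_exp (q e : R) : dom q e ->
  exists B, 0 < B /\ forall t, 0 < t -> kern q e t <= B * exp (- t / 2).
Proof.
  intros [Hq H].
  assert (HB : exists B, forall t, 0 < t -> e * ln t - t - q / t <= B + - t / 2).
  { destruct (Rle_lt_dec 0 e) as [He|He].
    - destruct (ln_le_affine e (1 / 2) He ltac:(lra)) as [B HB]. exists B.
      intros t Ht. specialize (HB t Ht).
      assert (0 <= q / t) by (apply Rmult_le_pos; [lra|apply Rlt_le, Rinv_0_lt_compat, Ht]).
      lra.
    - destruct H as [H|H]; [|lra].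
      destruct (ln_le_affine (- e) q ltac:(lra) H) as [B HB]. exists B.
      intros t Ht. specialize (HB (/ t) (Rinv_0_lt_compat _ Ht)).
      rewrite ln_Rinv in HB by auto. unfold Rdiv at 1. lra. }
  destruct HB as [B HB]. exists (exp B). split. apply exp_pos.
  intros t Ht. rewrite <- exp_plus. unfold kern. destruct (HB t Ht) as [h|h].
  left. now apply exp_increasing. rewrite h. apply Rle_refl.
Qed.

(** * Truncations [(u, v)] exhausting [(x, oo)], and convergence of the improper integral *)

Definition cut (x : R) : ((R * R) -> Prop) -> Prop :=
  filter_prod (at_right x) (Rbar_locally p_infty).

Global Instance cut_proper (x : R) : ProperFilter (cut x).
Proof. unfold cut. typeclasses eauto. Qed.

Lemma cut_box (x d M : R) : 0 < d -> cut x (fun ab => x < fst ab < x + d /\ M < snd ab).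
Proof.
  intros Hd. apply (Filter_prod _ _ _ (fun u => x < u < x + d) (fun v => M < v)).
  - exists (mkposreal d Hd). intros u Hu Hxu. split; auto.
    change (Rabs (u - x) < d) in Hu. apply Rabs_def2 in Hu. lra.
  - exists M. auto.
  - auto.
Qed.

Lemma cut_order (x : R) : cut x (fun ab => x < fst ab /\ fst ab < snd ab).
Proof.
  generalize (cut_box x 1 (x + 1) Rlt_0_1). apply filter_imp. intros; lra.
Qed.

Lemma is_RInt_gen_cut (f : R -> C) (x : R) (I : R * R -> C) (l : C) :
  cut x (fun ab => CRInt f (fst ab) (snd ab) (I ab)) -> Clim (cut x) I l ->
  @is_RInt_gen C_R_NormedModule f (at_right x) (Rbar_locally p_infty) l.
Proof.
  intros Hf HI P HP. apply (Clim_iff (cut x)) in HI. specialize (HI P HP).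
  change (cut x (fun ab => exists y, CRInt f (fst ab) (snd ab) y /\ P y)).
  generalize (filter_and _ _ Hf HI). apply filter_imp. intros ab [H1 H2].
  exists (I ab). split; auto.
Qed.

Lemma improper_cut (f : R -> C) (x : R) (I : R * R -> C) (l : C) :
  cut x (fun ab => CRInt f (fst ab) (snd ab) (I ab)) -> Clim (cut x) I l ->
  ex_improper f x /\ improper f x = l.
Proof.
  intros Hf HI. pose proof (is_RInt_gen_cut f x I l Hf HI) as H. split.
  - now exists l.
  - exact (@is_RInt_gen_unique C_R_CompleteNormedModule (at_right x) (Rbar_locally p_infty)
      _ _ f l H).
Qed.

Lemma exp_half_small (eps : R) : 0 < eps -> exists M, forall v, M < v -> exp (- v / 2) < eps.
Proof.
  intros He. exists (-2 * ln eps). intros v Hv. rewrite <- (exp_ln eps He).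
  apply exp_increasing. lra.
Qed.

Lemma is_RInt_exp_half (B u v : R) :
  is_RInt (fun t => B * exp (- t / 2)) u v (2 * B * exp (- u / 2) - 2 * B * exp (- v / 2)).
Proof.
  replace (2 * B * exp (- u / 2) - 2 * B * exp (- v / 2)) with
    (minus ((fun t => - 2 * B * exp (- t / 2)) v) ((fun t => - 2 * B * exp (- t / 2)) u)).
  2: unfold minus, plus, opp; simpl; ring.
  apply (@is_RInt_derive R_CompleteNormedModule (fun t => - 2 * B * exp (- t / 2))).
  - intros t _. auto_derive; auto. unfold Rdiv. set (E := exp _). field.
  - intros t _. apply (ex_derive_continuous (K := R_AbsRing) (V := R_NormedModule)).
    auto_derive. auto.
Qed.

(** Cauchy criterion: moving the lower endpoint costs at most its displacement times the bound [B]
    of the integrand, and moving the upper one is controlled by the exponential tail. *)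
Lemma J_converges (p nu : C) (x : R) : 0 <= x -> dom (Re p) (Re nu) ->
  exists l, Clim (cut x) (J p nu) l.
Proof.
  intros Hx Hd. destruct (kern_le_exp _ _ Hd) as [B [HB Hk]].
  apply (Clim_cauchy (cut x)). intros eps He.
  (* Each endpoint is allotted [eps / 4]; the tail integral is at most [2 * B * exp (- v / 2)],
     whence [eps / (8 * B)] for the exponential. *)
  assert (He1 : 0 < eps / (4 * B)) by (apply Rdiv_lt_0_compat; lra).
  destruct (exp_half_small (eps / (8 * B))) as [M HM]. { apply Rdiv_lt_0_compat; lra. }
  assert (E1 : eps / (4 * B) * B = eps / 4) by (field; lra).
  assert (E2 : eps / (8 * B) * B = eps / 8) by (field; lra).
  exists (fun ab => x < fst ab < x + eps / (4 * B) /\ Rmax 0 M < snd ab).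
  split. now apply cut_box.
  assert (HT : forall v v', Rmax 0 M < v -> Rmax 0 M < v' -> v <= v' ->
    Cmod (J p nu (v, v')) < eps / 4).
  { intros v v' Hv Hv' Hvv. pose proof (Rmax_l 0 M). pose proof (Rmax_r 0 M).
    eapply Rle_lt_trans.
    apply (CRInt_Cmod_le (K p nu) (fun t => B * exp (- t / 2)) v v'); auto.
    - intros t Ht. rewrite Cmod_K by lra. apply Hk. lra.
    - apply J_spec; lra.
    - apply is_RInt_exp_half.
    - pose proof (exp_pos (- v' / 2)). assert (h := HM v ltac:(lra)). nra. }
  assert (HT' : forall v v', Rmax 0 M < v -> Rmax 0 M < v' ->
    Cmod (J p nu (v, v')) < eps / 4).
  { intros v v' Hv Hv'. destruct (Rle_lt_dec v v'); auto.
    pose proof (Rmax_l 0 M).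
    replace (J p nu (v, v')) with (- J p nu (v', v))%C.
    rewrite Cmod_opp. apply HT; lra.
    symmetry. apply (CRInt_unique (K p nu) v v'). apply J_spec; lra.
    apply (@is_RInt_swap C_R_NormedModule). apply J_spec; lra. }
  intros [u v] [u' v'] [Hu Hv] [Hu' Hv']. simpl in *.
  pose proof (Rmax_l 0 M).
  replace (J p nu (u, v)) with (J p nu (u, u') + (J p nu (u', v') + J p nu (v', v)))%C.
  2:{ symmetry. apply (CRInt_unique (K p nu) u v). apply J_spec; lra.
      apply CRInt_Chasles with u'. apply J_spec; lra.
      apply CRInt_Chasles with v'; apply J_spec; lra. }
  replace (J p nu (u, u') + (J p nu (u', v') + J p nu (v', v)) - J p nu (u', v'))%C
    with (J p nu (u, u') + J p nu (v', v))%C by ring.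
  eapply Rle_lt_trans; [apply Cmod_triangle|].
  assert (H1 : Cmod (J p nu (u, u')) <= Rabs (u' - u) * B).
  { apply (CRInt_Cmod_le_const (K p nu)).
    - intros t [Ht _]. assert (0 < t) by (apply (Rmin_pos_lt u u'); lra).
      rewrite Cmod_K by lra. eapply Rle_trans; [apply Hk; auto|].
      rewrite <- (Rmult_1_r B) at 2. apply Rmult_le_compat_l. lra.
      rewrite <- exp_0. apply Rlt_le, exp_increasing. lra.
    - apply J_spec; lra. }
  assert (H2 := HT' v' v Hv' Hv).
  assert (H3 : Rabs (u' - u) <= eps / (4 * B)) by (apply Rabs_le; lra).
  assert (Rabs (u' - u) * B <= eps / 4). { rewrite <- E1. apply Rmult_le_compat_r; lra. }
  lra.
Qed.

Lemma cut_spec_J (p nu : C) (x : R) : 0 <= x ->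
  cut x (fun ab => CRInt (K p nu) (fst ab) (snd ab) (J p nu ab)).
Proof.
  intros Hx. generalize (cut_order x). apply filter_imp. intros [u v] H. simpl in *.
  apply J_spec; lra.
Qed.

Lemma Gamma_inc_eq (p nu : C) (x : R) (l : C) : 0 <= x ->
  Clim (cut x) (J p (nu - 1)%C) l -> Gamma_inc nu x p = l.
Proof.
  intros Hx Hl. exact (proj2 (improper_cut _ x _ l (cut_spec_J p (nu - 1)%C x Hx) Hl)).
Qed.

Lemma Re_minus1 (nu : C) : Re (nu - 1)%C = Re nu - 1.
Proof. destruct nu; reflexivity. Qed.

Lemma Gamma_inc_lim (p nu : C) (x : R) : 0 <= x -> dom (Re p) (Re nu - 1) ->
  Clim (cut x) (J p (nu - 1)%C) (Gamma_inc nu x p).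
Proof.
  intros Hx Hd. rewrite <- Re_minus1 in Hd. destruct (J_converges p _ x Hx Hd) as [l Hl].
  now rewrite (Gamma_inc_eq p nu x l Hx Hl).
Qed.

(** * Recurrence and lower bound for the incomplete Gamma function *)

(* At [x = 0] this is the limit of [K p nu] at [0+]; [K p nu 0] itself is a junk value. *)
Definition edge (p nu : C) (x : R) : C := if Rlt_dec 0 x then K p nu x else 0%R.

(** * Limits of the boundary terms of the integration by parts *)

Lemma cut_fst (x : R) (P : R -> Prop) : locally x P -> cut x (fun ab => P (fst ab)).
Proof.
  intros [d Hd]. generalize (cut_box x d 0 (cond_pos d)). apply filter_imp.
  intros ab [H _]. apply Hd. change (Rabs (fst ab - x) < d). apply Rabs_def1; lra.
Qed.

Lemma Cmod_le_parts (z : C) : Cmod z <= Rabs (Re z) + Rabs (Im z).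
Proof.
  replace z with (RtoC (Re z) + Ci * RtoC (Im z))%C at 1.
  - eapply Rle_trans; [apply Cmod_triangle|]. rewrite Cmod_mult, !Cmod_R.
    replace (Cmod Ci) with 1; [lra|]. unfold Cmod, Ci; simpl.
    replace (_ + _) with 1 by ring. now rewrite sqrt_1.
  - destruct z; unfold Ci, RtoC, Cmult, Cplus, Re, Im; simpl. f_equal; ring.
Qed.

Lemma is_derive_near (f : R -> R) (x l eps : R) : is_derive f x l -> 0 < eps ->
  locally x (fun t => Rabs (f t - f x) < eps).
Proof.
  intros H He.
  assert (Hc : continuous f x).
  { apply (ex_derive_continuous (K := R_AbsRing) (V := R_NormedModule)). now exists l. }
  exact (proj1 (filterlim_locally f (f x)) Hc (mkposreal _ He)).
Qed.

Lemma K_lower_lim_pos (p nu : C) (x : R) : 0 < x ->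
  Clim (cut x) (fun ab => K p nu (fst ab)) (K p nu x).
Proof.
  intros Hx eps He. assert (He2 : 0 < eps / 2) by lra.
  generalize (filter_and _ _ (cut_fst x _ (is_derive_near _ _ _ _ (is_derive_K_re p nu x Hx) He2))
    (filter_and _ _ (cut_fst x _ (is_derive_near _ _ _ _ (is_derive_K_im p nu x Hx) He2))
      (cut_order x))).
  apply filter_imp. intros ab [H1 [H2 H3]].
  rewrite !K_polar by lra. eapply Rle_lt_trans; [apply Cmod_le_parts|].
  unfold Re, Im, Cminus, Cplus, Copp; cbn [fst snd]. unfold Re, Im, Rminus in *. lra.
Qed.

(** The modulus is [t] times the kernel with exponent [Re nu - 1], which is bounded under [dom]. *)
Lemma K_lower_lim_0 (p nu : C) : dom (Re p) (Re nu - 1) ->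
  Clim (cut 0) (fun ab => K p nu (fst ab)) 0%R.
Proof.
  intros Hd. destruct (kern_le_exp _ _ Hd) as [B [HB Hk]]. intros eps He.
  generalize (cut_box 0 (eps / B) 0 (Rdiv_lt_0_compat _ _ He HB)). apply filter_imp.
  intros ab [[H1 H2] _]. replace (K p nu (fst ab) - 0%R)%C with (K p nu (fst ab)) by ring.
  rewrite Cmod_K by lra. replace (Re nu) with (Re nu - 1 + 1) by ring.
  rewrite kern_succ by auto. specialize (Hk _ H1).
  assert (exp (- fst ab / 2) <= 1). { rewrite <- exp_0. apply Rlt_le, exp_increasing. lra. }
  pose proof (kern_pos (Re p) (Re nu - 1) (fst ab)).
  assert (fst ab * B < eps).
  { replace eps with (eps / B * B) by (field; lra). apply Rmult_lt_compat_r; lra. }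
  assert (kern (Re p) (Re nu - 1) (fst ab) <= B) by nra. nra.
Qed.

Lemma K_lower_lim (p nu : C) (x : R) : 0 <= x -> dom (Re p) (Re nu - 1) ->
  Clim (cut x) (fun ab => K p nu (fst ab)) (edge p nu x).
Proof.
  intros Hx Hd. unfold edge. destruct Rlt_dec.
  - now apply K_lower_lim_pos.
  - replace x with 0 by lra. now apply K_lower_lim_0.
Qed.

Lemma K_lower_lim_low (nu : C) : 0 < Re nu ->
  Clim (cut 0) (fun ab => K 0%R nu (fst ab)) 0%R.
Proof.
  intros Hn eps He.
  (* The width is the power of [eps] with exponent [1 / Re nu], so that [t] to the power [Re nu]
     stays below [eps]. *)
  generalize (cut_box 0 (exp (ln eps / Re nu)) 0 (exp_pos _)). apply filter_imp.
  intros ab [[H1 H2] _]. replace (K 0%R nu (fst ab) - 0%R)%C with (K 0%R nu (fst ab)) by ring.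
  rewrite Cmod_K by lra. rewrite re_RtoC. rewrite <- (exp_ln eps He). apply exp_increasing.
  rewrite Rplus_0_l in H2. apply ln_increasing in H2; auto. rewrite ln_exp in H2.
  apply (Rmult_lt_compat_l (Re nu)) in H2; auto.
  replace (Re nu * (ln eps / Re nu)) with (ln eps) in H2 by (field; lra).
  unfold Rdiv. rewrite Rmult_0_l. lra.
Qed.

Lemma K_upper_lim (p nu : C) (x : R) : 0 <= x -> dom (Re p) (Re nu) ->
  Clim (cut x) (fun ab => K p nu (snd ab)) 0%R.
Proof.
  intros Hx Hd. destruct (kern_le_exp _ _ Hd) as [B [HB Hk]]. intros eps He.
  destruct (exp_half_small (eps / B)) as [M HM]. { now apply Rdiv_lt_0_compat. }
  generalize (cut_box x 1 (Rmax 0 M) Rlt_0_1). apply filter_imp.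
  intros ab [_ H]. pose proof (Rmax_l 0 M). pose proof (Rmax_r 0 M).
  replace (K p nu (snd ab) - 0%R)%C with (K p nu (snd ab)) by ring.
  rewrite Cmod_K by lra. eapply Rle_lt_trans; [apply Hk; lra|].
  replace eps with (B * (eps / B)) by (field; lra). apply Rmult_lt_compat_l; auto.
  apply HM. lra.
Qed.

Lemma Re_plusR (nu : C) (r : R) : Re (nu + r)%C = Re nu + r.
Proof. destruct nu; reflexivity. Qed.

Lemma J_ftc_cut (p nu : C) (x : R) : 0 <= x ->
  cut x (fun ab => K p nu (snd ab) - K p nu (fst ab) =
    nu * J p (nu - 1) ab - J p nu ab + p * J p (nu - 2) ab)%C.
Proof.
  intros Hx. generalize (cut_order x). apply filter_imp.
  intros [u v] [H1 H2]. simpl in H1, H2. cbn [fst snd]. apply J_ftc; lra.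
Qed.

Lemma Gamma_inc_lim_succ (p nu : C) (x : R) : 0 <= x -> dom (Re p) (Re nu) ->
  Clim (cut x) (J p nu) (Gamma_inc (nu + 1) x p).
Proof.
  intros Hx Hd. replace nu with (nu + 1 - 1)%C at 1 by ring. apply Gamma_inc_lim; auto.
  rewrite Re_plusR. now replace (Re nu + 1 - 1) with (Re nu) by ring.
Qed.

Lemma Gamma_inc_lim_pred (p nu : C) (x : R) : 0 <= x -> dom (Re p) (Re nu - 2) ->
  Clim (cut x) (J p (nu - 2)%C) (Gamma_inc (nu - 1) x p).
Proof.
  intros Hx Hd. replace (nu - 2)%C with (nu - 1 - 1)%C by ring. apply Gamma_inc_lim; auto.
  rewrite Re_minus1. now replace (Re nu - 1 - 1) with (Re nu - 2) by ring.
Qed.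

(** The limit of [J_ftc] along [cut x]: the boundary term at infinity vanishes and the lower one
    tends to [edge]. The lowest exponent that occurs is [nu - 2], which explains the hypothesis. *)
Lemma Gamma_inc_succ (p nu : C) (x : R) : 0 <= x -> dom (Re p) (Re nu - 2) ->
  Gamma_inc (nu + 1)%C x p =
  (nu * Gamma_inc nu x p + p * Gamma_inc (nu - 1)%C x p + edge p nu x)%C.
Proof.
  intros Hx Hd.
  assert (H1 : Clim (cut x) (fun ab => K p nu (snd ab) - K p nu (fst ab))%C (0%R - edge p nu x)%C).
  { apply (Clim_minus (cut x)).
    apply K_upper_lim; auto. apply dom_mono with (1 := Hd); lra.
    apply K_lower_lim; auto. apply dom_mono with (1 := Hd); lra. }
  assert (H2 : Clim (cut x) (fun ab => K p nu (snd ab) - K p nu (fst ab))%C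
    (nu * Gamma_inc nu x p - Gamma_inc (nu + 1) x p + p * Gamma_inc (nu - 1) x p)%C).
  { apply (Clim_ext (cut x)) with
      (fun ab => nu * J p (nu - 1) ab - J p nu ab + p * J p (nu - 2) ab)%C.
    - generalize (J_ftc_cut p nu x Hx). apply filter_imp. intros ab E; symmetry; exact E.
    - apply (Clim_plus (cut x)); [apply (Clim_minus (cut x))|].
      + apply (Clim_scal (cut x)), Gamma_inc_lim; auto. apply dom_mono with (1 := Hd); lra.
      + apply Gamma_inc_lim_succ; auto. apply dom_mono with (1 := Hd); lra.
      + apply (Clim_scal (cut x)), Gamma_inc_lim_pred; auto. }
  pose proof (Clim_unique (cut x) _ _ _ H1 H2) as E.
  set (G1 := Gamma_inc (nu + 1) x p) in *.
  replace G1 with (nu * Gamma_inc nu x p + p * Gamma_inc (nu - 1) x p -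
    (nu * Gamma_inc nu x p - G1 + p * Gamma_inc (nu - 1) x p))%C by ring.
  rewrite <- E. ring.
Qed.

(* Integration by parts also reaches the range [0 < Re nu < 1], where the integrand is
   unbounded at [0]. *)
Lemma Gamma_inc_lim_low (nu : C) : 0 < Re nu ->
  Clim (cut 0) (J 0%R (nu - 1)%C) (Gamma_inc nu 0 0%R) /\
  Gamma_inc (nu + 1)%C 0 0%R = (nu * Gamma_inc nu 0 0%R)%C.
Proof.
  intros Hn.
  assert (Hnu : nu <> 0%R) by (intros ->; rewrite re_RtoC in Hn; lra).
  assert (Hd : dom (Re 0%R) (Re nu)) by (rewrite re_RtoC; split; [lra|right; lra]).
  (* For [p = 0] the identity [J_ftc] can be solved for the integral with exponent [nu - 1], and
     everything else in it is known to converge. *)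
  assert (H : Clim (cut 0) (J 0%R (nu - 1)%C) (/ nu * (0%R - 0%R + Gamma_inc (nu + 1) 0 0%R))%C).
  { apply (Clim_ext (cut 0)) with
      (fun ab => / nu * (K 0%R nu (snd ab) - K 0%R nu (fst ab) + J 0%R nu ab))%C.
    - generalize (J_ftc_cut 0%R nu 0 (Rle_refl 0)). apply filter_imp. intros ab ->.
      field. exact Hnu.
    - apply (Clim_scal (cut 0)), (Clim_plus (cut 0)); [apply (Clim_minus (cut 0))|].
      apply K_upper_lim; auto; lra. apply K_lower_lim_low; auto.
      apply Gamma_inc_lim_succ; auto; lra. }
  rewrite (Gamma_inc_eq _ _ _ _ (Rle_refl 0) H). split; auto.
  field. exact Hnu.
Qed.

(** The incomplete Gamma function at real parameters, as a real number. Taking the modulus makes it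
    nonnegative without side conditions; [Gamma_inc_real] shows that on [dom] nothing is changed. *)
Definition Rg (q x s : R) : R := Cmod (Gamma_inc (RtoC s) x (RtoC q)).

Lemma Jr_nonneg (q s u v : R) : 0 < u <= v -> 0 <= Jr q s (u, v).
Proof.
  intros H. apply RInt_ge_0; simpl. lra. apply ex_RInt_kern; lra.
  intros t _. apply Rlt_le, kern_pos.
Qed.

Lemma Rg_lim (q x s : R) : 0 <= x -> dom q (s - 1) ->
  Clim (cut x) (fun ab => RtoC (Jr q (s - 1) ab)) (RtoC (Rg q x s)).
Proof.
  intros Hx Hd. apply (Clim_ext (cut x)) with (fun ab => RtoC (Cmod (J q (s - 1)%C ab))).
  - generalize (cut_order x). apply filter_imp. intros [u v] [H1 H2]. simpl in H1, H2.
    rewrite <- RtoC_minus, J_real, Cmod_R by lra. rewrite Rabs_pos_eq; auto.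
    apply Jr_nonneg. lra.
  - apply (Clim_Cmod (cut x)), Gamma_inc_lim; auto.
Qed.

Lemma Gamma_inc_real (q x s : R) : 0 <= x -> dom q (s - 1) ->
  Gamma_inc (RtoC s) x (RtoC q) = RtoC (Rg q x s).
Proof.
  intros Hx Hd. apply Gamma_inc_eq; auto. apply (Clim_ext (cut x)) with (2 := Rg_lim q x s Hx Hd).
  generalize (cut_order x). apply filter_imp. intros [u v] [H1 H2]. simpl in H1, H2.
  rewrite <- RtoC_minus, J_real by lra. reflexivity.
Qed.

(** The integrand is positive, so the integral only grows as the truncation is enlarged. *)
Lemma Jr_le_Rg (q x s u v : R) : 0 <= x -> dom q (s - 1) -> x < u <= v ->
  Jr q (s - 1) (u, v) <= Rg q x s.
Proof.
  intros Hx Hd Huv.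
  apply (Clim_le (cut x) (fun _ => Jr q (s - 1) (u, v)) (Jr q (s - 1))).
  - generalize (cut_box x (u - x) v ltac:(lra)). apply filter_imp.
    intros [a b] [H1 H2]. simpl in H1, H2.
    assert (E : Jr q (s - 1) (a, b) =
      Jr q (s - 1) (a, u) + (Jr q (s - 1) (u, v) + Jr q (s - 1) (v, b))).
    { unfold Jr; cbn [fst snd]. rewrite (RInt_Chasles (V := R_CompleteNormedModule) _ u v b).
      rewrite (RInt_Chasles (V := R_CompleteNormedModule)). reflexivity.
      all: apply ex_RInt_kern; lra. }
    rewrite E. assert (0 <= Jr q (s - 1) (a, u)) by (apply Jr_nonneg; lra).
    assert (0 <= Jr q (s - 1) (v, b)) by (apply Jr_nonneg; lra). lra.
  - apply (Clim_const (cut x)).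
  - now apply Rg_lim.
Qed.

Lemma Gamma_inc_le_Rg (p nu : C) (x : R) : 0 <= x -> dom (Re p) (Re nu - 1) ->
  Cmod (Gamma_inc nu x p) <= Rg (Re p) x (Re nu).
Proof.
  intros Hx Hd. apply (Clim_le (cut x) (fun ab => Cmod (J p (nu - 1) ab)) (Jr (Re p) (Re nu - 1))).
  - generalize (cut_order x). apply filter_imp. intros [u v] [H1 H2]. simpl in H1, H2.
    rewrite <- Re_minus1. apply J_le_Jr. lra.
  - apply (Clim_Cmod (cut x)), Gamma_inc_lim; auto.
  - now apply Rg_lim.
Qed.

(** The part of the integral over [[A, A + 1]] alone suffices, since [t ^ n] is at least [A ^ n]
    there. *)
Lemma Rg_geometric (q x s A : R) : 0 <= x < A -> dom q (s - 1) ->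
  exists c, 0 < c /\ forall n, c * A ^ n <= Rg q x (s + INR n).
Proof.
  intros HA Hd. exists (Jr q (s - 1) (A, A + 1)). split.
  - apply RInt_gt_0; simpl. lra. intros; apply kern_pos.
    intros t Ht. apply (ex_derive_continuous (K := R_AbsRing) (V := R_NormedModule)).
    eexists. apply is_derive_kern. lra.
  - intros n. apply Rle_trans with (Jr q (s + INR n - 1) (A, A + 1)).
    + rewrite Rmult_comm.
      apply (is_RInt_le (fun t => A ^ n * kern q (s - 1) t) (kern q (s + INR n - 1)) A (A + 1)).
      lra. apply (@is_RInt_scal R_NormedModule), Jr_spec; lra. apply Jr_spec; lra.
      intros t Ht. replace (s + INR n - 1) with (s - 1 + INR n) by ring.
      rewrite kern_pow by lra. apply Rmult_le_compat_r. apply Rlt_le, kern_pos.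
      apply pow_incr. lra.
    + apply Jr_le_Rg; try lra. apply dom_mono with (1 := Hd). pose proof (pos_INR n). lra.
Qed.

Lemma Rg_pos (q x s : R) : 0 <= x -> dom q (s - 1) -> 0 < Rg q x s.
Proof.
  intros Hx Hd. destruct (Rg_geometric q x s (x + 1) ltac:(lra) Hd) as [c [Hc H]].
  specialize (H O). simpl in H. rewrite Rplus_0_r in H. lra.
Qed.

Definition redge (q x s : R) : R := if Rlt_dec 0 x then kern q s x else 0.

Lemma redge_nonneg (q x s : R) : 0 <= redge q x s.
Proof. unfold redge. destruct Rlt_dec; [apply Rlt_le, kern_pos|apply Rle_refl]. Qed.

Lemma Cmod_edge (p nu : C) (x : R) : Cmod (edge p nu x) = redge (Re p) x (Re nu).
Proof. unfold edge, redge. destruct Rlt_dec. apply Cmod_K; lra. apply Cmod_0. Qed.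

Lemma Rg_succ (q x s : R) : 0 <= x -> dom q (s - 2) ->
  Rg q x (s + 1) = s * Rg q x s + q * Rg q x (s - 1) + redge q x s.
Proof.
  intros Hx Hd. apply RtoC_inj.
  rewrite !RtoC_plus, !RtoC_mult, <- !Gamma_inc_real; auto.
  - rewrite RtoC_plus, RtoC_minus, Gamma_inc_succ by auto. f_equal.
    unfold edge, redge. destruct Rlt_dec; auto. apply K_real. lra.
  - apply dom_mono with (1 := Hd); lra.
  - apply dom_mono with (1 := Hd); lra.
  - apply dom_mono with (1 := Hd); lra.
Qed.

Lemma Rg_succ_ge (q x s : R) : 0 <= x -> dom q (s - 2) -> s * Rg q x s <= Rg q x (s + 1).
Proof.
  intros Hx Hd. rewrite Rg_succ by auto. generalize (redge_nonneg q x s).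
  assert (0 <= Rg q x (s - 1)) by apply Cmod_ge_0. destruct Hd as [Hq _]. nra.
Qed.

(** The boundary value grows like [x ^ n], while the integral grows at least like [(x + 1) ^ n]. *)
Lemma redge_le_Rg (q x s : R) : 0 <= x -> dom q (s - 1) ->
  exists B, 0 <= B /\ forall n, redge q x (s + INR n) <= B * Rg q x (s + INR n).
Proof.
  intros Hx Hd. destruct (Rg_geometric q x s (x + 1) ltac:(lra) Hd) as [c [Hc H]].
  exists (kern q s x / c). split.
  - apply Rmult_le_pos. apply Rlt_le, kern_pos. apply Rlt_le, Rinv_0_lt_compat, Hc.
  - intros n. apply Rle_trans with (kern q s x / c * (c * (x + 1) ^ n)).
    + replace (kern q s x / c * (c * (x + 1) ^ n)) with ((x + 1) ^ n * kern q s x) by (field; lra).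
      unfold redge. destruct Rlt_dec.
      * rewrite kern_pow by auto. apply Rmult_le_compat_r. apply Rlt_le, kern_pos.
        apply pow_incr. lra.
      * apply Rmult_le_pos. apply pow_le; lra. apply Rlt_le, kern_pos.
    + apply Rmult_le_compat_l; auto. apply Rmult_le_pos. apply Rlt_le, kern_pos.
      apply Rlt_le, Rinv_0_lt_compat, Hc.
Qed.

(** * Lower bound for the modulus at complex parameters, and absence of zeros of Gamma *)

Lemma sinh_ge (y : R) : 0 <= y -> 2 * y <= exp y - exp (- y).
Proof.
  intros Hy. destruct (MVT_gen (fun t => exp t - exp (- t) - 2 * t) 0 y
    (fun t => exp t + exp (- t) - 2)) as [c [Hc E]].
  - intros t _. auto_derive; auto. ring.
  - intros t _. apply derivable_continuous_pt. apply ex_derive_Reals_0. auto_derive. auto.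
  - rewrite Ropp_0, exp_0 in E.
    assert (H : 0 <= exp c + exp (- c) - 2).
    { rewrite exp_Ropp. pose proof (exp_pos c).
      replace (exp c + / exp c - 2) with (Rsqr (exp c - 1) * / exp c) by (unfold Rsqr; field; lra).
      apply Rmult_le_pos. apply Rle_0_sqr. apply Rlt_le, Rinv_0_lt_compat; auto. }
    nra.
Qed.

(** With [v = exp (2 * y)] the right side is the square of [exp y - exp (- y)], hence at least
    [4 * y ^ 2]. *)
Lemma ln_sqr_le (v : R) : 0 < v -> ln v ^ 2 <= v - 2 + / v.
Proof.
  intros Hv. set (y := ln v / 2).
  assert (H : forall y, 4 * y ^ 2 <= (exp y - exp (- y)) ^ 2).
  { intros z. destruct (Rle_lt_dec 0 z) as [Hz|Hz].
    - generalize (sinh_ge z Hz). nra.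
    - generalize (sinh_ge (- z) ltac:(lra)). rewrite Ropp_involutive. nra. }
  specialize (H y).
  assert (E : exp y * exp (- y) = 1) by (rewrite <- exp_plus, Rplus_opp_r; apply exp_0).
  assert (E1 : exp y * exp y = v).
  { rewrite <- exp_plus. unfold y. replace (ln v / 2 + ln v / 2) with (ln v) by field.
    now apply exp_ln. }
  assert (E2 : exp (- y) * exp (- y) = / v).
  { rewrite <- exp_plus. unfold y. replace (- (ln v / 2) + - (ln v / 2)) with (- ln v) by field.
    rewrite exp_Ropp, exp_ln; auto. }
  replace (4 * y ^ 2) with (ln v ^ 2) in H by (unfold y; field). nra.
Qed.

Lemma cos_ge (y : R) : 1 - y ^ 2 / 2 <= cos y.
Proof.
  replace y with (2 * (y / 2)) at 2 by field. rewrite cos_2a_sin.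
  assert (Rabs (sin (y / 2)) <= Rabs (y / 2)).
  { destruct (MVT_gen sin 0 (y / 2) cos) as [c [_ E]].
    - intros t _. auto_derive; auto. ring.
    - intros t _. apply continuity_sin.
    - rewrite sin_0, !Rminus_0_r in E. rewrite E, Rabs_mult.
      rewrite <- (Rmult_1_l (Rabs (y / 2))) at 2. apply Rmult_le_compat_r. apply Rabs_pos.
      apply Rabs_le, COS_bound. }
  apply Rsqr_le_abs_1 in H. unfold Rsqr in H. nra.
Qed.

(* The integrand has phase [tau ln t - Im p / t], nearly constant where the mass of
   [t^(s-1) exp(-t)] sits, namely around [t = s]; hence little cancellation. *)
Lemma Gamma_inc_ge (p nu : C) (x : R) : 0 <= x -> 0 <= Re p -> 3 <= Re nu ->
  let s := Re nu in let R := Rg (Re p) x in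
  R s - Im nu ^ 2 * (R (s + 1) / s - 2 * R s + s * R (s - 1)) - Im p ^ 2 * R (s - 2)
  <= Cmod (Gamma_inc nu x p).
Proof.
  intros Hx Hp Hs s R. set (q := Re p) in *. set (tau := Im nu). set (pi := Im p).
  assert (Hdom : forall e, 0 <= e -> dom q e) by (intros; split; auto).
  set (jc := fun ab => Jr q (s - 1) ab - tau ^ 2 *
    (Jr q s ab / s - 2 * Jr q (s - 1) ab + s * Jr q (s - 2) ab) - pi ^ 2 * Jr q (s - 3) ab).
  assert (Hs' : 3 <= s) by exact Hs.
  apply (Clim_le (cut x) jc (fun ab => Cmod (J p (nu - 1) ab))).
  - generalize (cut_order x). apply filter_imp. intros [u v] [H1 H2]. simpl in H1, H2.
    (* A rotation of modulus 1 that subtracts the constant [tau * ln s] from the phase; the real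
       part of the rotated integral then bounds the modulus from below. *)
    set (w := (cos (tau * ln s), - sin (tau * ln s)) : C).
    apply Rle_trans with (Cmod (w * J p (nu - 1) (u, v))%C).
    2:{ rewrite Cmod_mult. replace (Cmod w) with 1; [lra|].
        unfold Cmod, w; simpl. replace (_ + _) with
          (Rsqr (sin (tau * ln s)) + Rsqr (cos (tau * ln s))) by (unfold Rsqr; ring).
        now rewrite sin2_cos2, sqrt_1. }
    eapply Rle_trans; [|apply re_le_Cmod]. eapply Rle_trans; [|apply Rle_abs].
    assert (HI := CRInt_mult w _ _ _ _ (J_spec p (nu - 1) u v ltac:(lra) ltac:(lra))).
    apply CRInt_iff in HI. destruct HI as [HI _].
    assert (HI' : is_RInt (fun t => kern q (s - 1) t - tau ^ 2 *
       (kern q s t / s - 2 * kern q (s - 1) t + s * kern q (s - 2) t) - pi ^ 2 * kern q (s - 3) t)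
       u v (jc (u, v))).
    { assert (HJ : forall e, is_RInt (kern q e) u v (Jr q e (u, v))) by (intros; apply Jr_spec; lra).
      assert (HS : forall c e, is_RInt (fun t => c * kern q e t) u v (c * Jr q e (u, v))).
      { intros c e. exact (@is_RInt_scal R_NormedModule _ u v c _ (HJ e)). }
      assert (HM := @is_RInt_minus R_NormedModule). assert (HP := @is_RInt_plus R_NormedModule).
      assert (H0 := HM _ _ u v _ _ (HP _ _ u v _ _ (HJ (s - 1))
        (HP _ _ u v _ _ (HP _ _ u v _ _ (HS (- tau ^ 2 / s) s) (HS (2 * tau ^ 2) (s - 1)))
          (HS (- tau ^ 2 * s) (s - 2)))) (HS (pi ^ 2) (s - 3))).
      cbv beta in H0.
      match type of H0 with is_RInt _ _ _ ?l => replace (jc (u, v)) with l end.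
      - apply (@is_RInt_ext R_NormedModule) with (2 := H0). intros t _.
        unfold minus, plus, opp; simpl. unfold Rdiv. ring.
      - unfold jc, minus, plus, opp; simpl. unfold Rdiv. ring. }
    apply (is_RInt_le _ _ u v _ _ ltac:(lra) HI' HI).
    intros t Ht. assert (Ht0 : 0 < t) by lra.
    rewrite K_polar by lra. rewrite Re_minus1. fold s q.
    set (k := kern q (s - 3) t).
    assert (E1 : kern q (s - 2) t = t * k).
    { replace (s - 2) with (s - 3 + 1) by ring. now apply kern_succ. }
    assert (E2 : kern q (s - 1) t = t * (t * k)).
    { rewrite <- E1. replace (s - 1) with (s - 2 + 1) by ring. now apply kern_succ. }
    assert (E3 : kern q s t = t * (t * (t * k))).
    { rewrite <- E2. replace s with (s - 1 + 1) at 1 by ring. now apply kern_succ. }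
    set (th := phase p (nu - 1) t).
    assert (Eth : th = tau * ln t - pi / t).
    { unfold th, phase, tau, pi. destruct nu; unfold Im; simpl. ring. }
    assert (Hcos := cos_ge (th - tau * ln s)).
    rewrite cos_minus in Hcos.
    (* This replaces the squared logarithm by integer powers of [t], which only shift the exponent
       of the kernel, so that the error integrates to neighbouring values of [Rg]. *)
    assert (Hln := ln_sqr_le (t / s) ltac:(apply Rdiv_lt_0_compat; lra)).
    rewrite ln_div in Hln by lra.
    assert (Hy : (th - tau * ln s) ^ 2 <= 2 * (tau ^ 2 * (ln t - ln s) ^ 2) + 2 * (pi / t) ^ 2).
    { rewrite Eth. generalize (Rle_0_sqr (tau * (ln t - ln s) + pi / t)). unfold Rsqr. nra. }
    assert (Hb : 1 - tau ^ 2 * (t / s - 2 + / (t / s)) - (pi / t) ^ 2 <=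
      cos th * cos (tau * ln s) + sin th * sin (tau * ln s)).
    { assert (tau ^ 2 * (ln t - ln s) ^ 2 <= tau ^ 2 * (t / s - 2 + / (t / s)))
        by (apply Rmult_le_compat_l; [apply pow2_ge_0|auto]). lra. }
    assert (Hk : 0 < t * (t * k)) by (rewrite <- E2; apply kern_pos).
    apply (Rmult_le_compat_l _ _ _ (Rlt_le _ _ Hk)) in Hb.
    rewrite E1, E2, E3. unfold w. cbn [fst snd Cmult].
    eapply Rle_trans; [eapply Rle_trans; [|exact Hb]|].
    + apply Req_le. field. lra.
    + apply Req_le. ring.
  - assert (HR : forall e, 1 <= e ->
      Clim (cut x) (fun ab => RtoC (Jr q (e - 1) ab)) (RtoC (R e))).
    { intros e He. apply Rg_lim; auto. apply Hdom. lra. }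
    assert (HR1 := HR (s + 1) ltac:(lra)). assert (HR0 := HR s ltac:(lra)).
    assert (HRm := HR (s - 1) ltac:(lra)). assert (HRm2 := HR (s - 2) ltac:(lra)).
    replace (s + 1 - 1) with s in HR1 by ring.
    replace (s - 1 - 1) with (s - 2) in HRm by ring.
    replace (s - 2 - 1) with (s - 3) in HRm2 by ring.
    unfold jc, Rdiv.
    apply (Clim_ext (cut x)) with (fun ab => RtoC (Jr q (s - 1) ab) - RtoC (tau ^ 2)%R *
      (RtoC (/ s) * RtoC (Jr q s ab) - RtoC 2 * RtoC (Jr q (s - 1) ab)
        + RtoC s * RtoC (Jr q (s - 2) ab)) - RtoC (pi ^ 2)%R * RtoC (Jr q (s - 3) ab))%C.
    { apply filter_forall. intros ab.
      repeat (rewrite <- RtoC_mult || rewrite <- RtoC_plus || rewrite <- RtoC_minus).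
      apply f_equal. unfold Rdiv. ring. }
    match goal with |- Clim _ _ ?l => replace l with (RtoC (R s) - RtoC (tau ^ 2)%R *
      (RtoC (/ s) * RtoC (R (s + 1)%R) - RtoC 2 * RtoC (R s)
        + RtoC s * RtoC (R (s - 1)%R)) - RtoC (pi ^ 2)%R * RtoC (R (s - 2)%R))%C end.
    2:{ repeat (rewrite <- RtoC_mult || rewrite <- RtoC_plus || rewrite <- RtoC_minus).
      apply f_equal. unfold Rdiv. ring. }
    repeat (first [assumption | apply (Clim_minus (cut x)) | apply (Clim_plus (cut x))
      | apply (Clim_scal (cut x))]).
  - apply (Clim_Cmod (cut x)), Gamma_inc_lim; auto. apply Hdom. fold s. lra.
Qed.

(** By the recurrence for [Rg] the leading terms of the bracket in [Gamma_inc_ge] cancel. The two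
    errors together are then at most a constant times [Rg q x s / (s - 2)], which for large [s] is
    less than half of the main term. *)
Lemma Gamma_inc_ge_half (p nu : C) (x : R) : 0 <= x -> 0 <= Re p ->
  exists N, forall n, (N <= n)%nat -> 4 <= Re nu + INR n /\
    Rg (Re p) x (Re nu + INR n) / 2 <= Cmod (Gamma_inc (nu + INR n)%C x p).
Proof.
  intros Hx Hp. set (q := Re p) in *.
  assert (Hdom : forall e, 0 <= e -> dom q e) by (intros; split; auto).
  destruct (INR_unbounded (4 - Re nu)) as [N0 HN0].
  destruct (redge_le_Rg q x (Re nu + INR N0)) as [B [HB HBn]]; auto.
  { apply Hdom. lra. }
  set (D := Im nu ^ 2 * (1 + q + B) + Im p ^ 2).
  (* Beyond [N1] one has [2 * D <= s - 2], so that errors of total size [D * a / (s - 2)] stay below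
     [a / 2]. *)
  destruct (INR_unbounded (2 + 2 * D - Re nu)) as [N1 HN1].
  exists (Nat.max N0 N1). intros n Hn.
  assert (Hn0 : INR N0 <= INR n) by (apply le_INR; lia).
  assert (Hn1 : INR N1 <= INR n) by (apply le_INR; lia).
  split. lra.
  set (s := Re nu + INR n). assert (Hs : 4 <= s) by (unfold s; lra).
  assert (HX : redge q x s <= B * Rg q x s).
  { unfold s. replace (Re nu + INR n) with (Re nu + INR N0 + INR (n - N0)).
    apply HBn. rewrite minus_INR by lia. ring. }
  assert (HG := Gamma_inc_ge p (nu + INR n) x Hx Hp). rewrite Re_plusR in HG.
  specialize (HG ltac:(lra)). cbv zeta in HG. fold s q in HG.
  eapply Rle_trans; [|exact HG]. clear HG.
  replace (Im (nu + INR n)%C) with (Im nu) by (destruct nu; unfold Im; simpl; ring).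
  assert (D0 : dom q (s - 2)) by (apply Hdom; lra).
  assert (P0 : 0 < Rg q x s) by (apply Rg_pos; auto; apply Hdom; lra).
  assert (P1 : 0 < Rg q x (s - 1)) by (apply Rg_pos; auto; apply Hdom; lra).
  assert (P2 : 0 < Rg q x (s - 2)) by (apply Rg_pos; auto; apply Hdom; lra).
  assert (S0 := Rg_succ q x s Hx D0).
  assert (S1 : (s - 1) * Rg q x (s - 1) <= Rg q x (s - 1 + 1))
    by (apply Rg_succ_ge; auto; apply Hdom; lra).
  assert (S2 : (s - 2) * Rg q x (s - 2) <= Rg q x (s - 2 + 1))
    by (apply Rg_succ_ge; auto; apply Hdom; lra).
  replace (s - 1 + 1) with s in S1 by ring. replace (s - 2 + 1) with (s - 1) in S2 by ring.
  rewrite S0.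
  set (a := Rg q x s) in *. set (b := Rg q x (s - 1)) in *. set (c := Rg q x (s - 2)) in *.
  set (X := redge q x s) in *. assert (HX0 : 0 <= X) by apply redge_nonneg.
  assert (Hc : (s - 2) * c <= a) by nra.
  (* After cancellation there remain [(q * b + X) / s] and [s * b - a]; the latter is at most [b]
     because [(s - 1) * b <= a]. *)
  assert (Hm : (s - 2) * ((s * a + q * b + X) / s - 2 * a + s * b) <= (1 + q + B) * a).
  { replace ((s - 2) * ((s * a + q * b + X) / s - 2 * a + s * b)) with
      ((s - 2) / s * (q * b + X) + (s - 2) * (s * b - a)) by (field; lra).
    assert (Hf : 0 <= (s - 2) / s <= 1).
    { split. apply Rmult_le_pos. lra. apply Rlt_le, Rinv_0_lt_compat; lra.
      apply (Rmult_le_reg_r s). lra. field_simplify; lra. }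
    assert (Hba : b <= a) by nra.
    assert (Hqb : 0 <= q * b <= q * a)
      by (split; [apply Rmult_le_pos|apply Rmult_le_compat_l]; lra).
    assert (T1 : (s - 2) / s * (q * b + X) <= q * a + B * a).
    { apply Rle_trans with (1 * (q * b + X)); [apply Rmult_le_compat_r|]; lra. }
    assert (T2 : (s - 2) * (s * b - a) <= a).
    { apply Rle_trans with ((s - 2) * b); [apply Rmult_le_compat_l|]; lra. }
    lra. }
  assert (HD : 2 * D <= s - 2) by (unfold s; lra).
  set (M := (s * a + q * b + X) / s - 2 * a + s * b) in *.
  assert (HF : (s - 2) * (Im nu ^ 2 * M + Im p ^ 2 * c) <= (s - 2) * (a / 2)).
  { assert (0 <= Im nu ^ 2) by apply pow2_ge_0. assert (0 <= Im p ^ 2) by apply pow2_ge_0.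
    apply Rle_trans with (D * a).
    - unfold D. nra.
    - nra. }
  apply Rmult_le_reg_l in HF; lra.
Qed.

(** By the functional equation a zero at [nu] would propagate to every [nu + n], against the lower
    bound for large [n]. *)
Lemma Gamma_inc0_neq_0 (nu : C) : 0 < Re nu -> Gamma_inc nu 0 0%R <> 0%R.
Proof.
  intros Hn E.
  assert (H0 : forall n, Gamma_inc (nu + INR n)%C 0 0%R = 0%R).
  { induction n. replace (nu + INR 0)%C with nu by (simpl; ring). exact E.
    rewrite S_INR, RtoC_plus, Cplus_assoc.
    assert (Hp : 0 < Re (nu + INR n)%C) by (rewrite Re_plusR; pose proof (pos_INR n); lra).
    rewrite (proj2 (Gamma_inc_lim_low _ Hp)), IHn. ring. }
  destruct (Gamma_inc_ge_half 0%R nu 0 (Rle_refl 0)) as [N HN]. rewrite re_RtoC; lra.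
  destruct (HN N (Nat.le_refl N)) as [H1 H2]. rewrite H0, Cmod_0, re_RtoC in H2.
  assert (0 < Rg 0 0 (Re nu + INR N)) by (apply Rg_pos; [lra|split; [lra|right; lra]]). lra.
Qed.

Lemma Poch_neq_0 (a : C) (n : nat) : (forall k : nat, a <> (- INR k)%C) -> Poch a n <> 0%R.
Proof.
  intros H. induction n; simpl. exact C1_nz.
  apply Cmult_neq_0; auto. intros E. apply (H n).
  replace a with (a + INR n - INR n)%C by ring. rewrite E. ring.
Qed.

Lemma Gamma_neq_0 (nu : C) : (forall k : nat, nu <> (- INR k)%C) -> Gamma nu <> 0%R.
Proof.
  intros H. unfold Gamma. set (N := Z.to_nat (up (- Re nu))).
  assert (HP := Poch_neq_0 nu N H).
  assert (HN : 0 < Re nu + INR N).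
  { destruct (archimed (- Re nu)) as [Hu _].
    assert (IZR (up (- Re nu)) <= INR N).
    { rewrite INR_IZR_INZ. apply IZR_le. unfold N. lia. } lra. }
  apply Cmult_neq_0.
  - apply Gamma_inc0_neq_0. now rewrite Re_plusR.
  - intros E. apply C1_nz. rewrite <- (Cinv_r _ HP), E. ring.
Qed.

(** * Bounded variation *)

Local Opaque Gamma_inc Rg J K.

Lemma Rsum_ext (a b : nat -> R) (n : nat) :
  (forall k, (k < n)%nat -> a k = b k) -> Rsum a n = Rsum b n.
Proof. intros H. apply Rle_antisym; apply Rsum_le; intros k Hk; rewrite H by auto; lra. Qed.

Lemma is_derive_Rsum (f df : nat -> R -> R) (t : R) (n : nat) :
  (forall k, is_derive (f k) t (df k t)) ->
  is_derive (fun y => Rsum (fun k => f k y) n) t (Rsum (fun k => df k t) n).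
Proof.
  intros H. induction n; simpl.
  - apply (@is_derive_const R_AbsRing R_NormedModule).
  - apply (@is_derive_plus R_AbsRing R_NormedModule); auto.
Qed.

Lemma kern_le_kern0 (q s t : R) : 0 <= q -> 0 < t -> kern q s t <= kern 0 s t.
Proof.
  intros Hq Ht. unfold kern.
  assert (0 <= q / t) by (apply Rmult_le_pos; [lra|apply Rlt_le, Rinv_0_lt_compat, Ht]).
  replace (0 / t) with 0 by (field; lra).
  destruct H as [H|H].
  - left. apply exp_increasing. lra.
  - rewrite <- H. lra.
Qed.

(* For [q = x = 0] and integral [s] the sum is [exp (- T)] times a tail of the exponential series; in
   general it satisfies the corresponding differential inequality. *)
Lemma kern_sum_bound (q x s : R) : 0 <= q -> 0 <= x -> 2 <= s ->
  exists B, 0 <= B /\ forall T m, 0 < T ->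
    Rsum (fun n => kern q (s + INR n) T / Rg q x (s + INR n + 1)) m <= B.
Proof.
  intros Hq Hx Hs.
  assert (Hdom : forall e, 0 <= e -> dom q e) by (intros; split; auto).
  assert (HR : forall n, 0 < Rg q x (s + INR n + 1)).
  { intros n. pose proof (pos_INR n). apply Rg_pos; auto. apply Hdom. lra. }
  destruct (kern_le_exp 0 (s - 1)) as [B [HB Hk]]. { split; [lra|right; lra]. }
  assert (HR0 : 0 < Rg q x s) by (apply Rg_pos; auto; apply Hdom; lra).
  set (C := B / Rg q x s). assert (HC : 0 < C) by (apply Rdiv_lt_0_compat; auto).
  exists (2 * C). split. lra. intros T m HT.
  set (w := fun n => / Rg q x (s + INR n + 1)).
  assert (Hw : forall n, 0 < w n) by (intros n; apply Rinv_0_lt_compat, HR).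
  (* Only the numerators lose the factor [exp (- q / T)]; the weights [w] keep [q] and [x]. *)
  apply Rle_trans with (Rsum (fun n => kern 0 (s + INR n) T * w n) m).
  { apply Rsum_le. intros n _. apply Rmult_le_compat_r. now apply Rlt_le.
    now apply kern_le_kern0. }
  (* The added exponential makes [f] nonincreasing: its derivative compensates the single positive
     term left by telescoping. As [f] is at most about [2 * C] near 0, the sum is bounded by [2 * C]
     everywhere. *)
  set (f := fun t => Rsum (fun n => kern 0 (s + INR n) t * w n) m + 2 * C * exp (- t / 2)).
  set (df := fun t => Rsum (fun n => kern 0 (s + INR n) t * ((s + INR n) / t - 1 + 0 / t ^ 2) * w n) m
     - C * exp (- t / 2)).
  assert (Hf : forall t, 0 < t -> is_derive f t (df t)).
  { intros t Ht. unfold f, df.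
    apply (@is_derive_plus R_AbsRing R_NormedModule).
    - apply (is_derive_Rsum (fun n t => kern 0 (s + INR n) t * w n)
        (fun n t => kern 0 (s + INR n) t * ((s + INR n) / t - 1 + 0 / t ^ 2) * w n)).
      intros n. assert (H := is_derive_kern 0 (s + INR n) t Ht).
      set (g := kern 0 (s + INR n)) in *. auto_derive. now exists (g t * ((s + INR n) / t - 1 + 0 / t ^ 2)).
      rewrite (is_derive_unique (fun t : R => g t) _ _ H). ring.
    - auto_derive; auto. unfold Rdiv, opp; simpl. set (E := exp _). field. }
  assert (Hdf : forall t, 0 < t -> df t <= 0).
  { intros t Ht. unfold df.
    assert (H1 : Rsum (fun n => kern 0 (s + INR n) t * ((s + INR n) / t - 1 + 0 / t ^ 2) * w n) m <=
      kern 0 (s - 1) t / Rg q x s).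
    (* Since [(s + n) * w n] is at most the preceding weight, the positive part of each derivative
       is cancelled by the negative part of the one before; the induction carries the last negative
       part along. *)
    { apply Rle_trans with (kern 0 (s - 1) t / Rg q x s -
        match m with O => 0 | S k => kern 0 (s + INR k) t * w k end).
      - clear f df Hf. induction m as [|m IH]; cbn [Rsum].
        + assert (0 < kern 0 (s - 1) t / Rg q x s) by (apply Rdiv_lt_0_compat; auto; apply kern_pos). lra.
        + assert (Hm : kern 0 (s + INR m) t * ((s + INR m) / t) * w m <=
            match m with O => kern 0 (s - 1) t / Rg q x s | S k => kern 0 (s + INR k) t * w k end).
          { pose proof (pos_INR m).
            assert (E : kern 0 (s + INR m) t = t * kern 0 (s + INR m - 1) t).
            { rewrite <- kern_succ by auto. f_equal. ring. }
            rewrite E.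
            replace (t * kern 0 (s + INR m - 1) t * ((s + INR m) / t) * w m) with
              (kern 0 (s + INR m - 1) t * ((s + INR m) * w m)) by (field; lra).
            assert (Hw' : (s + INR m) * w m <= / Rg q x (s + INR m)).
            { assert (HRm : 0 < Rg q x (s + INR m)) by (apply Rg_pos; auto; apply Hdom; lra).
              assert (Hge : (s + INR m) * Rg q x (s + INR m) <= Rg q x (s + INR m + 1))
                by (apply Rg_succ_ge; auto; apply Hdom; lra).
              unfold w. apply (Rmult_le_reg_r (Rg q x (s + INR m))); auto.
              rewrite Rinv_l by lra. apply (Rmult_le_reg_r (Rg q x (s + INR m + 1))). apply HR.
              rewrite Rmult_1_l. specialize (HR m).
              replace (_ * _) with ((s + INR m) * Rg q x (s + INR m)) by (field; lra). lra. }
            apply Rle_trans with (kern 0 (s + INR m - 1) t * / Rg q x (s + INR m)).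
            apply Rmult_le_compat_l; auto. apply Rlt_le, kern_pos.
            apply Req_le. destruct m.
            - simpl. rewrite !Rplus_0_r. reflexivity.
            - rewrite S_INR. unfold w. replace (s + (INR m + 1) - 1) with (s + INR m) by ring.
              now rewrite Rplus_assoc. }
          assert (E0 : 0 / t ^ 2 = 0) by (field; lra). rewrite E0 in IH |- *.
          destruct m; cbn [Rsum] in *; lra.
      - destruct m. lra. generalize (Hw m) (kern_pos 0 (s + INR m) t). nra. }
    assert (H2 : kern 0 (s - 1) t / Rg q x s <= C * exp (- t / 2)).
    { unfold C. replace (B / Rg q x s * exp (- t / 2)) with (B * exp (- t / 2) / Rg q x s)
        by (field; lra).
      apply Rmult_le_compat_r. now apply Rlt_le, Rinv_0_lt_compat. now apply Hk. }
    lra. }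
  (* For [t <= 1] each kernel in the sum is at most [t * B], so the sum is at most [t * W] and
     disappears as [t] tends to 0. *)
  set (W := Rsum (fun n => B * w n) m).
  assert (HW : 0 <= W).
  { apply Rsum_nonneg. intros n. apply Rmult_le_pos; apply Rlt_le; auto. }
  assert (Hsmall : forall t, 0 < t <= 1 -> t <= T -> f T <= t * W + 2 * C).
  { intros t Ht HtT. apply Rle_trans with (f t).
    - destruct (MVT_gen f t T df) as [c [Hc E]].
      + intros y Hy. apply Hf. rewrite Rmin_left in Hy; lra.
      + intros y Hy. apply derivable_continuous_pt, ex_derive_Reals_0. exists (df y).
        apply Hf. rewrite Rmin_left in Hy; lra.
      + rewrite Rmin_left in Hc by lra. generalize (Hdf c ltac:(lra)). nra.
    - unfold f. assert (H0 : exp (- t / 2) <= 1).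
      { rewrite <- exp_0. apply Rlt_le, exp_increasing. lra. }
      assert (H1 : Rsum (fun n => kern 0 (s + INR n) t * w n) m <= t * W).
      { unfold W. replace (t * _) with (Rsum (fun n => t * (B * w n) + 0 * 0) m).
        2:{ rewrite (Rsum_lin t 0 (fun n => B * w n) (fun _ => 0)). ring. }
        apply Rsum_le. intros n _. rewrite kern_pow by lra.
        replace s with (s - 1 + 1) at 1 by ring. rewrite kern_succ by lra.
        assert (Hp : 0 <= t ^ n <= 1).
        { split. apply pow_le; lra. rewrite <- (pow1 n). apply pow_incr. lra. }
        assert (Hkb : kern 0 (s - 1) t <= B).
        { eapply Rle_trans; [apply Hk; lra|]. pose proof (exp_pos (- t / 2)). nra. }
        pose proof (kern_pos 0 (s - 1) t).
        assert (t ^ n * (t * kern 0 (s - 1) t) <= t * B).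
        { apply Rle_trans with (1 * (t * kern 0 (s - 1) t)).
          apply Rmult_le_compat_r. nra. lra. rewrite Rmult_1_l. apply Rmult_le_compat_l; lra. }
        generalize (Hw n). nra. }
      nra. }
  assert (HfT : f T <= 2 * C).
  { apply le_epsilon. intros eps He.
    set (t := Rmin (Rmin 1 T) (eps / (W + 1))).
    assert (Ht1 : t <= eps / (W + 1)) by apply Rmin_r.
    assert (Ht2 : t <= Rmin 1 T) by apply Rmin_l.
    pose proof (Rmin_l 1 T). pose proof (Rmin_r 1 T).
    assert (Ht0 : 0 < t).
    { apply Rmin_pos. apply Rmin_pos; lra. apply Rdiv_lt_0_compat; lra. }
    assert (t * W <= eps).
    { apply Rle_trans with (eps / (W + 1) * (W + 1)).
      apply Rmult_le_compat; lra. apply Req_le. field. lra. }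
    generalize (Hsmall t ltac:(lra) ltac:(lra)). lra. }
  unfold f in HfT. pose proof (exp_pos (- T / 2)). nra.
Qed.

Lemma half_recurrence_sum (delta t : nat -> R) (m : nat) :
  (forall n, delta (S n) <= delta n / 2 + t n) -> (forall n, 0 <= delta n) ->
  (forall n, 0 <= t n) -> Rsum delta m <= 2 * delta O + 2 * Rsum t m.
Proof.
  intros H Hd Ht.
  (* The extra [delta m] is what the induction step halves to pay for the next term. *)
  assert (Hm : Rsum delta (S m) + delta m <= 2 * delta O + 2 * Rsum t m).
  { induction m; cbn [Rsum] in *. lra. generalize (H m). lra. }
  cbn [Rsum] in Hm. generalize (Hd m). lra.
Qed.

(** Numerators and denominators of [phi] satisfy the same three-term recurrence up to boundary
    terms. Eliminating gives a recurrence for the differences of [phi] with contraction factor 1/2,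
    whose inhomogeneous part is summable uniformly in [u] and [v] by [kern_sum_bound]. *)
Lemma J_ratio_variation (p nu : C) (x : R) : 0 <= x -> 0 <= Re p ->
  exists N B, (forall n, (N <= n)%nat -> Gamma_inc (nu + INR n)%C x p <> 0%R) /\
    forall u v, x < u < v ->
    let phi n := (J p (nu + INR n - 1) (u, v) / Gamma_inc (nu + INR n) x p)%C in
    (forall n, (N <= n)%nat -> Cmod (phi n) <= B) /\
    forall m, Rsum (fun k => Cmod (phi (N + k)%nat - phi (N + S k)%nat)%C) m <= B.
Proof.
  intros Hx Hp. destruct (Gamma_inc_ge_half p nu x Hx Hp) as [N0 HN0].
  (* This ensures [4 * Cmod p <= s], so that the coefficient [p] loses against the growth of [r]
     over two steps and leaves the factor 1/2. *)
  destruct (INR_unbounded (4 * Cmod p - Re nu)) as [N1 HN1].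
  set (N := Nat.max N0 N1). set (q := Re p) in *.
  assert (Hdom : forall e, 0 <= e -> dom q e) by (intros; split; auto).
  assert (H4 : forall n, (N <= n)%nat -> 4 <= Re nu + INR n).
  { intros n Hn. exact (proj1 (HN0 n ltac:(unfold N in Hn; lia))). }
  set (s := Re nu + INR N).
  assert (Hs4 : 4 <= s) by exact (H4 N (Nat.le_refl N)).
  assert (Hsp : 4 * Cmod p <= s).
  { assert (INR N1 <= INR N) by (apply le_INR; unfold N; lia). unfold s. lra. }
  set (g := fun n => Gamma_inc (nu + INR n)%C x p).
  set (r := fun n => Rg q x (Re nu + INR n)).
  assert (Hrpos : forall n, (N <= n)%nat -> 0 < r n).
  { intros n Hn. specialize (H4 n Hn). apply Rg_pos; [exact Hx|]. apply Hdom. lra. }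
  assert (Hgr : forall n, (N <= n)%nat -> r n / 2 <= Cmod (g n)).
  { intros n Hn. exact (proj2 (HN0 n ltac:(unfold N in Hn; lia))). }
  assert (Hg0 : forall n, (N <= n)%nat -> g n <> 0%R).
  { intros n Hn E. specialize (Hgr n Hn). specialize (Hrpos n Hn).
    rewrite E, Cmod_0 in Hgr. lra. }
  destruct (kern_sum_bound q x (s + 1) Hp Hx ltac:(lra)) as [B [HB HBs]].
  (* In [half_recurrence_sum] the first difference is at most 4 and the sum of [t] at most [8 * B];
     both are doubled. *)
  exists N, (8 + 16 * B). split. exact Hg0.
  intros u v Huv. cbv zeta. set (j := fun n => J p (nu + INR n - 1)%C (u, v)).
  set (phi := fun n => (j n / g n)%C).
  assert (Hphi : forall n, (N <= n)%nat -> Cmod (phi n) <= 2).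
  { intros n Hn. unfold phi. rewrite Cmod_div by auto.
    assert (Hj : Cmod (j n) <= r n).
    { unfold j, r. eapply Rle_trans; [apply J_le_Jr; lra|].
      rewrite Re_minus1, Re_plusR. fold q. apply Jr_le_Rg; auto; [|lra].
      apply Hdom. specialize (H4 n Hn). lra. }
    specialize (Hgr n Hn). specialize (Hrpos n Hn).
    apply (Rmult_le_reg_r (Cmod (g n))). lra.
    unfold Rdiv. rewrite Rmult_assoc, Rinv_l by lra. lra. }
  split.
  { intros n Hn. change (Cmod (phi n) <= 8 + 16 * B). specialize (Hphi n Hn). lra. }
  intros m.
  set (delta := fun k => Cmod (phi (N + k)%nat - phi (N + S k)%nat)%C).
  set (y := fun T n => kern q (s + 1 + INR n) T / Rg q x (s + 1 + INR n + 1)).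
  set (e := fun n => redge q x (s + 1 + INR n) / Rg q x (s + 1 + INR n + 1)).
  (* The outer 2 comes from dividing by [g], whose modulus is at least [r / 2]; the inner one is the
     bound on [phi]. *)
  set (t := fun n => 2 * (2 * e n + (y v n + y u n))).
  assert (Hrr : forall n, Rg q x (s + 1 + INR n + 1) = r (N + S (S n))%nat).
  { intros n. unfold r, s. rewrite plus_INR, !S_INR. f_equal. ring. }
  assert (Hy : forall T n, 0 <= y T n).
  { intros T n. unfold y. rewrite Hrr. apply Rmult_le_pos. apply Rlt_le, kern_pos.
    apply Rlt_le, Rinv_0_lt_compat, Hrpos. lia. }
  assert (He : forall n, 0 <= e n).
  { intros n. unfold e. rewrite Hrr. apply Rmult_le_pos. apply redge_nonneg.
    apply Rlt_le, Rinv_0_lt_compat, Hrpos. lia. }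
  (* For [0 < x] the edge terms are the boundary terms at [T = x], so the same bound applies. *)
  assert (Hes : Rsum e m <= B).
  { unfold e, redge. destruct (Rlt_dec 0 x). now apply HBs.
    rewrite (Rsum_ext _ (fun _ => 0 * 0 + 0 * 0)) by (intros; unfold Rdiv; ring).
    rewrite (Rsum_lin 0 0 (fun _ => 0) (fun _ => 0)). lra. }
  assert (Hrec : forall n, delta (S n) <= delta n / 2 + t n).
  { intros n. unfold delta.
    set (a := (nu + INR (N + S n))%C).
    assert (Ea : (nu + INR (N + n) = a - 1)%C).
    { unfold a. rewrite Nat.add_succ_r, S_INR, RtoC_plus. ring. }
    assert (Ea2 : (nu + INR (N + S (S n)) = a + 1)%C).
    { unfold a. rewrite (Nat.add_succ_r N (S n)), S_INR, RtoC_plus. ring. }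
    assert (HRea : Re a = s + 1 + INR n).
    { unfold a, s. rewrite Re_plusR, plus_INR, S_INR. ring. }
    pose proof (pos_INR n) as Hn0.
    set (g0 := g (N + n)%nat). set (g1 := g (N + S n)%nat). set (g2 := g (N + S (S n))%nat).
    set (f0 := phi (N + n)%nat). set (f1 := phi (N + S n)%nat). set (f2 := phi (N + S (S n))%nat).
    assert (E1 : g2 = (a * g1 + p * g0 + edge p a x)%C).
    { unfold g2, g1, g0, g. fold a. rewrite Ea, Ea2. apply Gamma_inc_succ; auto.
      apply Hdom. lra. }
    assert (E2 : (K p a v - K p a u = a * (f1 * g1) - f2 * g2 + p * (f0 * g0))%C).
    { assert (Hfg : forall k, (N <= k)%nat -> (phi k * g k = j k)%C).
      { intros k Hk. unfold phi. field. now apply Hg0. }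
      unfold f1, g1, f2, g2, f0, g0. rewrite !Hfg by lia. unfold j. fold a.
      rewrite Ea, Ea2. replace (a + 1 - 1)%C with a by ring.
      replace (a - 1 - 1)%C with (a - 2)%C by ring. apply J_ftc; lra. }
    (* The recurrence for [g] times [f1], minus the truncated recurrence: the terms with coefficient
       [a] cancel. *)
    assert (E3 : (g2 * (f1 - f2) = p * (g0 * (f1 - f0)) + edge p a x * f1 + (K p a v - K p a u))%C).
    { rewrite E2. replace (g2 * (f1 - f2))%C with (g2 * f1 - f2 * g2)%C by ring.
      rewrite E1 at 1. ring. }
    assert (Hr0 := Hrpos (N + n)%nat ltac:(lia)).
    assert (Hr2 := Hrpos (N + S (S n))%nat ltac:(lia)).
    assert (Hg2 := Hgr (N + S (S n))%nat ltac:(lia)). fold g2 in Hg2.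
    assert (Hgr0 : Cmod g0 <= r (N + n)%nat).
    { unfold g0, g, r. rewrite <- Re_plusR. apply Gamma_inc_le_Rg; auto.
      rewrite Ea, Re_minus1. apply Hdom. lra. }
    assert (Hr02 : s * r (N + n)%nat <= r (N + S (S n))%nat).
    { assert (Hg1 : (s + INR n) * r (N + n)%nat <= Rg q x (s + INR n + 1)).
      { unfold r. replace (Re nu + INR (N + n)) with (s + INR n)
          by (unfold s; rewrite plus_INR; ring). apply Rg_succ_ge; auto. apply Hdom. lra. }
      assert (Hg1' : (s + INR n + 1) * Rg q x (s + INR n + 1) <= r (N + S (S n))%nat).
      { rewrite <- Hrr. replace (s + 1 + INR n + 1) with (s + INR n + 1 + 1) by ring.
        apply Rg_succ_ge; auto. apply Hdom. lra. }
      assert (s * r (N + n)%nat <= (s + INR n) * r (N + n)%nat) by nra.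
      nra. }
    assert (Hf1 : Cmod f1 <= 2) by (apply Hphi; lia).
    assert (Hmod : Cmod g2 * Cmod (f1 - f2)%C <=
      Cmod p * (r (N + n)%nat * Cmod (f0 - f1)%C) + redge q x (Re a) * 2
      + (kern q (Re a) v + kern q (Re a) u)).
    { rewrite <- Cmod_mult, E3. eapply Rle_trans; [apply Cmod_triangle|].
      apply Rplus_le_compat. eapply Rle_trans; [apply Cmod_triangle|].
      apply Rplus_le_compat.
      - rewrite !Cmod_mult, (Cmod_sym f1). apply Rmult_le_compat_l. apply Cmod_ge_0.
        apply Rmult_le_compat_r; auto. apply Cmod_ge_0.
      - rewrite Cmod_mult, Cmod_edge. apply Rmult_le_compat_l; auto. apply redge_nonneg.
      - eapply Rle_trans; [apply Cmod_triangle|]. rewrite Cmod_opp, !Cmod_K by lra.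
        apply Rle_refl. }
    rewrite HRea in Hmod.
    assert (Hid : redge q x (s + 1 + INR n) * 2
      + (kern q (s + 1 + INR n) v + kern q (s + 1 + INR n) u) =
      r (N + S (S n))%nat / 2 * t n).
    { unfold t, e, y. rewrite Hrr. field. lra. }
    rewrite Rplus_assoc, Hid in Hmod.
    set (D := Cmod (f1 - f2)%C) in *. set (D0 := Cmod (f0 - f1)%C) in *.
    assert (HD : 0 <= D) by apply Cmod_ge_0. assert (HD0 : 0 <= D0) by apply Cmod_ge_0.
    set (R2 := r (N + S (S n))%nat) in *. set (R0 := r (N + n)%nat) in *.
    assert (H1 : R2 / 2 * D <= Cmod g2 * D) by (apply Rmult_le_compat_r; auto).
    assert (H2 : Cmod p * (R0 * D0) <= R2 / 4 * D0).
    { rewrite <- Rmult_assoc. apply Rmult_le_compat_r; auto. nra. }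
    apply (Rmult_le_reg_l (R2 / 2)). lra. nra. }
  assert (H := half_recurrence_sum delta t m Hrec).
  assert (H0 : delta O <= 4).
  { unfold delta. eapply Rle_trans; [apply Cmod_triangle|]. rewrite Cmod_opp.
    assert (H1 := Hphi (N + 0)%nat ltac:(lia)). assert (H2 := Hphi (N + 1)%nat ltac:(lia)). lra. }
  assert (Hts : Rsum t m <= 8 * B).
  { unfold t. rewrite (Rsum_ext _ (fun n => 4 * e n + 1 * (2 * y v n + 2 * y u n)))
      by (intros; ring).
    rewrite (Rsum_lin 4 1 e (fun n => 2 * y v n + 2 * y u n)), (Rsum_lin 2 2 (y v) (y u)).
    assert (Rsum (y v) m <= B) by (apply HBs; lra).
    assert (Rsum (y u) m <= B) by (apply HBs; lra). lra. }
  specialize (H (fun n => Cmod_ge_0 _)).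
  assert (Ht0 : forall n, 0 <= t n).
  { intros n. unfold t. generalize (He n) (Hy v n) (Hy u n). lra. }
  specialize (H Ht0). change (Rsum delta m <= 8 + 16 * B). lra.
Qed.

(** * Termwise integration *)

Lemma bounded_of_eventually (f : nat -> R) (N : nat) : forall B,
  (forall n, (N <= n)%nat -> f n <= B) -> exists B', forall n, f n <= B'.
Proof.
  induction N; intros B H.
  - exists B. intros n. apply H. lia.
  - apply (IHN (Rmax B (f N))). intros n Hn.
    destruct (Nat.eq_dec n N) as [->|Hne]. apply Rmax_r.
    eapply Rle_trans; [apply H; lia|apply Rmax_l].
Qed.

(* Terms of a convergent series are bounded and Gamma_inc grows faster than any geometric
   sequence, so the coefficients decay faster than any geometric sequence. *)
Lemma coef_decay (p nu : C) (x : R) (d : nat -> C) (B : C) : 0 <= x -> 0 <= Re p ->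
  Csums (fun n => d n * Gamma_inc (nu + INR n) x p)%C B ->
  forall A, 0 < A -> exists M, forall n, Cmod (d n) * A ^ n <= M.
Proof.
  intros Hx Hp HB A HA.
  destruct (Gamma_inc_ge_half p nu x Hx Hp) as [N0 HN0].
  destruct (Csums_tail _ _ 1 HB Rlt_0_1) as [N1 HN1].
  (* [A'] exceeds [x], as [Rg_geometric] requires, and is at least [A]. *)
  set (N := Nat.max N0 N1). set (A' := A + x).
  assert (Hd : dom (Re p) (Re nu + INR N - 1)).
  { split; auto. right. generalize (proj1 (HN0 N ltac:(unfold N; lia))). lra. }
  destruct (Rg_geometric (Re p) x (Re nu + INR N) A' ltac:(unfold A'; lra) Hd) as [c [Hc HR]].
  apply (bounded_of_eventually _ N (2 * A ^ N / c)). intros n Hn.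
  replace n with (N + (n - N))%nat by lia. set (k := (n - N)%nat).
  assert (H1 := proj2 (HN0 (N + k)%nat ltac:(unfold N; lia))).
  assert (H2 := proj1 (HN1 (N + k)%nat 1%nat ltac:(unfold N; lia))).
  cbn [Csum] in H2. rewrite Cplus_0_l, Nat.add_0_r, Cmod_mult in H2.
  specialize (HR k). rewrite Rplus_assoc, <- plus_INR in HR.
  set (G := Cmod (Gamma_inc _ x p)) in *.
  assert (HA' : A ^ k <= A' ^ k) by (apply pow_incr; unfold A'; lra).
  assert (Hk : 0 < A ^ k) by now apply pow_lt.
  assert (HN : 0 < A ^ N) by now apply pow_lt.
  pose proof (Cmod_ge_0 (d (N + k)%nat)) as Hd0. set (D := Cmod (d (N + k)%nat)) in *.
  assert (HG : c * A ^ k <= 2 * G).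
  { apply Rle_trans with (c * A' ^ k). apply Rmult_le_compat_l; lra. lra. }
  rewrite pow_add. apply (Rmult_le_reg_l c); auto.
  replace (c * (2 * A ^ N / c)) with (2 * A ^ N) by (field; lra).
  apply Rle_trans with (A ^ N * (D * (2 * G))).
  - replace (c * (D * (A ^ N * A ^ k))) with (A ^ N * (D * (c * A ^ k))) by ring.
    apply Rmult_le_compat_l. lra. apply Rmult_le_compat_l; auto.
  - nra.
Qed.

(** * Geometric majorants and uniform convergence on compact intervals *)

Lemma Rsum_geom_le (B : R) (m n : nat) : 0 <= B ->
  Rsum (fun k => B / 2 ^ (m + k)) n <= 2 * B / 2 ^ m.
Proof.
  intros HB.
  assert (H2 : forall k, 0 < 2 ^ k) by (intros; apply pow_lt; lra).
  assert (H : Rsum (fun k => B / 2 ^ (m + k)) n = 2 * B / 2 ^ m - 2 * B / 2 ^ (m + n)).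
  { induction n; cbn [Rsum]. rewrite Nat.add_0_r; ring.
    rewrite IHn, Nat.add_succ_r. simpl. specialize (H2 (m + n)%nat).
    specialize (H2). generalize (pow_lt 2 m Rlt_0_2). intros. field. lra. }
  rewrite H. assert (0 <= 2 * B / 2 ^ (m + n)).
  { apply Rmult_le_pos. lra. apply Rlt_le, Rinv_0_lt_compat, H2. }
  lra.
Qed.

Lemma geom_small (B eps : R) : 0 <= B -> 0 < eps ->
  exists N, forall n, (N <= n)%nat -> B / 2 ^ n < eps.
Proof.
  intros HB He. destruct (INR_unbounded (B / eps)) as [N HN]. exists N. intros n Hn.
  assert (H2 : INR n < 2 ^ n).
  { clear. induction n. simpl; lra. rewrite S_INR. simpl.
    assert (1 <= 2 ^ n) by (apply pow_R1_Rle; lra). lra. }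
  apply le_INR in Hn. assert (Hp : 0 < 2 ^ n) by (apply pow_lt; lra).
  apply (Rmult_lt_reg_r (2 ^ n)); auto. unfold Rdiv. rewrite Rmult_assoc, Rinv_l by lra.
  apply (Rmult_lt_compat_r eps) in HN; auto. unfold Rdiv in HN.
  rewrite Rmult_assoc, Rinv_l in HN by lra. nra.
Qed.

(** The remainder estimate depends on [B] alone, so for a family with a common majorant it expresses
    uniform convergence. *)
Lemma geom_series (a : nat -> C) (B : R) : (forall n, Cmod (a n) <= B / 2 ^ n) ->
  Csums a (Cseries a) /\ forall n, Cmod (Csum a n - Cseries a)%C <= 2 * B / 2 ^ n.
Proof.
  intros Ha.
  assert (HB : 0 <= B).
  { generalize (Ha O) (Cmod_ge_0 (a O)). simpl. lra. }
  assert (Hblock : forall m k, Cmod (Csum a (m + k) - Csum a m)%C <= 2 * B / 2 ^ m).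
  { intros m k. rewrite Csum_split.
    replace (_ + _ - _)%C with (Csum (fun j => a (m + j)%nat) k) by ring.
    eapply Rle_trans; [apply Cmod_Csum_le|]. eapply Rle_trans; [|now apply (Rsum_geom_le B m k)].
    apply Rsum_le. auto. }
  assert (H : exists l, Csums a l).
  { apply (Clim_cauchy eventually). intros eps He.
    destruct (geom_small (2 * B) (eps / 2) ltac:(lra) ltac:(lra)) as [N HN].
    exists (fun n => (N <= n)%nat). split. now exists N.
    intros m n Hm Hn. specialize (HN N (Nat.le_refl N)).
    assert (H1 := Hblock N (m - N)%nat). assert (H2 := Hblock N (n - N)%nat).
    replace (N + (m - N))%nat with m in H1 by lia.
    replace (N + (n - N))%nat with n in H2 by lia.
    replace (Csum a m - Csum a n)%C with ((Csum a m - Csum a N) + (Csum a N - Csum a n))%C by ring.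
    eapply Rle_lt_trans; [apply Cmod_triangle|]. rewrite (Cmod_sym (Csum a N)). lra. }
  destruct H as [l Hl]. rewrite (Cseries_unique a l Hl). split; auto.
  intros n. rewrite Cmod_sym.
  apply (Clim_Cmod_le eventually (fun m => Csum a m - Csum a n)%C).
  - exists n. intros m Hm. replace m with (n + (m - n))%nat by lia. apply Hblock.
  - apply (Clim_minus eventually). exact Hl. apply (Clim_const eventually).
Qed.

(** Cauchy estimates at every radius: the power series with coefficients [d] has infinite radius of
    convergence. *)
Definition entire_coef (d : nat -> C) : Prop :=
  forall A, 0 < A -> exists M, forall n, Cmod (d n) * A ^ n <= M.

Lemma entire_geom (d : nat -> C) (A : R) : entire_coef d -> 0 < A ->
  exists B, 0 <= B /\ forall t, 0 <= t <= A -> forall n, Cmod (d n * t ^ n)%C <= B / 2 ^ n.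
Proof.
  (* Doubling the radius yields the factor [2 ^ n] in the denominator. *)
  intros Hd HA. destruct (Hd (2 * A) ltac:(lra)) as [B HB]. exists B. split.
  { generalize (HB O) (Cmod_ge_0 (d O)). simpl. lra. }
  intros t Ht n.
  rewrite Cmod_mult, <- RtoC_pow, Cmod_R, Rabs_pos_eq by (apply pow_le; lra).
  specialize (HB n). rewrite Rpow_mult_distr in HB.
  assert (H2 : 0 < 2 ^ n) by (apply pow_lt; lra).
  apply (Rmult_le_reg_r (2 ^ n)); auto. unfold Rdiv. rewrite (Rmult_assoc B), Rinv_l by lra.
  assert (t ^ n <= A ^ n) by (apply pow_incr; lra).
  assert (0 <= t ^ n) by (apply pow_le; lra).
  pose proof (Cmod_ge_0 (d n)).
  assert (Cmod (d n) * t ^ n * 2 ^ n <= Cmod (d n) * A ^ n * 2 ^ n).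
  { apply Rmult_le_compat_r. lra. apply Rmult_le_compat_l; auto. }
  lra.
Qed.

Lemma CRInt_Csum (f : nat -> R -> C) (l : nat -> C) (u v : R) (n : nat) :
  (forall k, CRInt (f k) u v (l k)) -> CRInt (fun t => Csum (fun k => f k t) n) u v (Csum l n).
Proof.
  intros H. induction n; cbn [Csum].
  - generalize (CRInt_mult 0%R _ _ _ _ (H O)). rewrite Cmult_0_l. apply CRInt_ext.
    intros; ring.
  - now apply CRInt_plus.
Qed.

(** [filterlim_RInt] takes uniform convergence on the whole line; composing with this projection
    onto [[u, v]] provides it without changing values on the interval. *)
Definition clip (u v t : R) : R := Rmax u (Rmin v t).

Lemma clip_range (u v t : R) : u <= v -> u <= clip u v t <= v.
Proof.
  intros H. unfold clip. split. apply Rmax_l. apply Rmax_lub; auto. apply Rmin_l.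
Qed.

Lemma clip_id (u v t : R) : u <= t <= v -> clip u v t = t.
Proof. intros H. unfold clip. rewrite Rmin_right, Rmax_right; lra. Qed.

Lemma K_bounded (p nu : C) (u v : R) : 0 < u <= v -> 0 <= Re p ->
  exists B, 0 <= B /\ forall t, u <= t <= v -> Cmod (K p nu t) <= B.
Proof.
  intros Hu Hp. set (L := Rabs (ln u) + Rabs (ln v)).
  exists (exp (Rabs (Re nu) * L)). split. apply Rlt_le, exp_pos.
  intros t Ht. rewrite Cmod_K by lra. unfold kern.
  assert (H1 : ln u <= ln t) by (apply ln_le; lra).
  assert (H2 : ln t <= ln v) by (apply ln_le; lra).
  assert (H3 : Rabs (ln t) <= L).
  { unfold L. apply Rabs_le. generalize (Rle_abs (ln v)) (Rabs_pos (ln v)) (Rabs_pos (ln u)).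
    generalize (Rle_abs (- ln u)). rewrite Rabs_Ropp. lra. }
  assert (H4 : Re nu * ln t <= Rabs (Re nu) * L).
  { eapply Rle_trans; [apply Rle_abs|]. rewrite Rabs_mult. apply Rmult_le_compat_l; auto.
    apply Rabs_pos. }
  assert (H5 : 0 <= Re p / t) by (apply Rmult_le_pos; auto; apply Rlt_le, Rinv_0_lt_compat; lra).
  apply Rnot_lt_le. intros Hlt. apply exp_lt_inv in Hlt. lra.
Qed.

(** Away from 0 and infinity the kernel is bounded and the power series converges uniformly, so sum
    and integral commute. *)
Lemma termwise_integration (p nu : C) (d : nat -> C) (u v : R) : 0 < u < v -> 0 <= Re p ->
  entire_coef d ->
  exists I, CRInt (fun t => K p nu t * Cseries (fun n => d n * t ^ n))%C u v I /\
    Csums (fun n => d n * J p (nu + INR n) (u, v))%C I.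
Proof.
  intros Huv Hp Hd.
  destruct (entire_geom d v Hd ltac:(lra)) as [B [HB HBn]].
  destruct (K_bounded p nu u v ltac:(lra) Hp) as [M [HM HMt]].
  set (a := fun t n => (d n * t ^ n)%C : C).
  set (F := fun t : R => Cseries (a t)).
  set (f := fun (n : nat) (t : R) => (K p nu (clip u v t) * Csum (a (clip u v t)) n)%C : C_R_NormedModule).
  set (g := fun t : R => (K p nu (clip u v t) * F (clip u v t))%C : C_R_NormedModule).
  set (h := fun n => Csum (fun k => d k * J p (nu + INR k) (u, v))%C n : C_R_NormedModule).
  destruct (@filterlim_RInt nat C_R_CompleteNormedModule f u v eventually _ g h) as [I [HI1 HI2]].
  - intros n. change (CRInt (f n) u v (h n)).
    apply CRInt_ext with (fun t => Csum (fun k => d k * K p (nu + INR k) t)%C n).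
    + intros t Ht. rewrite Rmin_left, Rmax_right in Ht by lra.
      unfold f. rewrite clip_id by lra. rewrite <- Csum_scal. apply Csum_ext.
      intros k _. unfold a. rewrite K_mul_pow by lra. ring.
    + apply (CRInt_Csum (fun k t => d k * K p (nu + INR k) t)%C
        (fun k => d k * J p (nu + INR k) (u, v))%C).
      intros k. apply CRInt_mult, J_spec; lra.
  - apply (proj2 (@filterlim_locally nat (fct_UniformSpace R C_R_NormedModule) eventually _ f g)).
    intros eps.
    destruct (geom_small (M * (2 * B)) eps) as [N HN].
    { apply Rmult_le_pos; lra. } { apply cond_pos. }
    exists N. intros n Hn t. apply C_ball_of_Cmod. unfold f, g.
    assert (Hc := clip_range u v t ltac:(lra)). set (c := clip u v t) in *.
    replace (K p nu c * Csum (a c) n - K p nu c * F c)%C with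
      (K p nu c * (Csum (a c) n - F c))%C by ring.
    rewrite Cmod_mult. apply Rle_lt_trans with (2 := HN n Hn).
    unfold Rdiv. rewrite Rmult_assoc. apply Rmult_le_compat; try apply Cmod_ge_0.
    + now apply HMt.
    + apply (geom_series (a c) B). intros k. apply HBn. lra.
  - exists I. split.
    + apply CRInt_ext with (2 := HI2). intros t Ht.
      rewrite Rmin_left, Rmax_right in Ht by lra. unfold g. rewrite clip_id by lra. reflexivity.
    + now apply (Clim_iff eventually).
Qed.

(** [toeplitz_regularity] along [cut x], applied to the termwise integrals over [(u, v)]. The second
    alternative of the hypothesis admits [0 < Re nu < 1], where [dom] fails. *)
Lemma improper_power_series (p nu : C) (x : R) (d : nat -> C) (B : C) : 0 <= x ->
  dom (Re p) (Re nu - 1) \/ (p = 0%R /\ x = 0 /\ 0 < Re nu) ->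
  Csums (fun n => d n * Gamma_inc (nu + INR n) x p)%C B ->
  entire_coef d /\
  ex_improper (fun t => K p (nu - 1) t * Cseries (fun n => d n * t ^ n))%C x /\
  improper (fun t => K p (nu - 1) t * Cseries (fun n => d n * t ^ n))%C x = B.
Proof.
  intros Hx Hcase HB.
  assert (Hp : 0 <= Re p).
  { destruct Hcase as [[H _]|[-> _]]; auto. rewrite re_RtoC. lra. }
  assert (Hd : entire_coef d) by exact (coef_decay p nu x d B Hx Hp HB).
  split; [exact Hd|].
  assert (Hlim : forall n, Clim (cut x) (J p (nu + INR n - 1)%C) (Gamma_inc (nu + INR n)%C x p)).
  { intros n. pose proof (pos_INR n). destruct Hcase as [Hdom|[-> [-> Hnu]]].
    - apply Gamma_inc_lim; auto. rewrite Re_plusR. apply dom_mono with (1 := Hdom). lra.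
    - apply Gamma_inc_lim_low. rewrite Re_plusR. lra. }
  destruct (J_ratio_variation p nu x Hx Hp) as [N [M [HN HM]]].
  set (f := fun t : R => (K p (nu - 1) t * Cseries (fun n => d n * t ^ n))%C).
  assert (HI : exists I : R * R -> C, forall u v, x < u < v -> CRInt f u v (I (u, v)) /\
    Csums (fun n => d n * J p (nu + INR n - 1) (u, v))%C (I (u, v))).
  { exists (fun ab => @RInt C_R_CompleteNormedModule f (fst ab) (snd ab)). intros u v Huv.
    destruct (termwise_integration p (nu - 1) d u v ltac:(lra) Hp Hd) as [l [H1 H2]].
    cbn [fst snd]. rewrite (@is_RInt_unique C_R_CompleteNormedModule f u v l H1).
    split; [exact H1|].
    apply (Clim_ext eventually) with (2 := H2). exists O. intros m _. apply Csum_ext.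
    intros k _. do 2 f_equal. ring. }
  destruct HI as [I HI].
  apply (improper_cut f x I B).
  - generalize (cut_order x). apply filter_imp. intros [u v] [H1 H2]. simpl in H1, H2.
    now apply HI.
  - set (b := fun n => (d n * Gamma_inc (nu + INR n) x p)%C) in *.
    set (c := fun n ab => (d n * J p (nu + INR n - 1) ab)%C).
    (* Below [N] the denominator may vanish; only the values from [N] on are used. *)
    set (phi := fun n ab => (J p (nu + INR n - 1) ab / Gamma_inc (nu + INR n) x p)%C).
    pose proof (toeplitz_regularity (cut x) b B c phi I N M HB) as HT.
    apply HT; clear HT.
    + intros n. apply (Clim_scal (cut x)), Hlim.
    + intros n ab Hn. unfold b, c, phi. field. now apply HN.
    + generalize (cut_order x). apply filter_imp. intros [u v] [H1 H2]. simpl in H1, H2.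
      split; [now apply HI|exact (HM u v (conj H1 H2))].
Qed.

(** * The hypergeometric identity *)

Lemma Csums_scal (c : C) (a : nat -> C) (l : C) : Csums a l -> Csums (fun n => c * a n)%C (c * l)%C.
Proof.
  intros H. apply (Clim_ext eventually) with (fun n => c * Csum a n)%C.
  - exists O. intros n _. symmetry. apply Csum_scal.
  - now apply (Clim_scal eventually).
Qed.

Lemma pFq_term_mul (alpha beta : list C) (z : C) (t : R) (n : nat) :
  pFq_term alpha beta (z * t) n = (pFq_term alpha beta z n * t ^ n)%C.
Proof.
  unfold pFq_term, Cdiv. rewrite Cpow_mult_l. ring.
Qed.

Open Scope C_scope.

(** [Cseries] and [improper] are total; the first two conclusions guarantee that on [(x, oo)] the
    inner series, and then the integral, have genuine values rather than defaults. *)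
Theorem theorem1 (r s : nat) (hr : (1 <= r)%nat)
    (alpha1 : C) (alpha beta : list C)
    (halpha : length alpha = (r - 1)%nat) (hbeta : length beta = s)
    (halpha1 : forall k : nat, alpha1 <> - INR k)
    (hbetaZ : forall b : C, In b beta -> forall k : nat, b <> - INR k)
    (x : R) (hx : (0 <= x)%R) (p : C)
    (hp : (0 < Re p)%R \/ (p = 0 /\ x = 0%R /\ (0 < Re alpha1)%R))
    (z : C) (hz : ex_Cseries (rGammas_term alpha1 x p alpha beta z)) :
  let integrand := fun t : R =>
    Rcpow t (alpha1 - 1) * Cexp (- t - p / t) * pFq alpha beta (z * t) in
  (forall t : R, (x < t)%R -> ex_Cseries (pFq_term alpha beta (z * t))) /\
  ex_improper integrand x /\
  rGammas alpha1 x p alpha beta z = 1 / Gamma alpha1 * improper integrand x.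
Proof.
  intros integrand.
  assert (HG : Gamma alpha1 <> 0) by now apply Gamma_neq_0.
  set (d := pFq_term alpha beta z).
  assert (HS : exists S : C, Csums (rGammas_term alpha1 x p alpha beta z) S).
  { destruct hz as [S HS]. exists S. now apply is_series_Csums. }
  destruct HS as [S HS].
  (* Multiplying by [Gamma alpha1] clears the denominator of each incomplete Pochhammer symbol. *)
  assert (HB : Csums (fun n => d n * Gamma_inc (alpha1 + INR n) x p) (Gamma alpha1 * S)).
  { apply (Clim_ext eventually) with (2 := Csums_scal (Gamma alpha1) _ _ HS).
    exists O. intros m _. apply Csum_ext. intros n _.
    unfold rGammas_term, Poch_inc, d, pFq_term, Cdiv.
    set (g := Gamma_inc _ x p). transitivity (Gamma alpha1 * / Gamma alpha1 *
      (Poch_prod alpha n * / Poch_prod beta n * (z ^ n * / INR (fact n)) * g)).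
    ring. rewrite Cinv_r by auto. ring. }
  assert (Hcase : dom (Re p) (Re alpha1 - 1) \/ (p = 0%R /\ x = 0%R /\ (0 < Re alpha1)%R)).
  { destruct hp as [Hp|Hp]; [left|right; exact Hp]. split; [lra|now left]. }
  destruct (improper_power_series p alpha1 x d _ hx Hcase HB) as [Hd HI].
  assert (Ei : integrand = fun t => K p (alpha1 - 1) t * Cseries (fun n => d n * t ^ n)).
  { apply functional_extensionality. intros t. unfold integrand, pFq.
    replace (pFq_term alpha beta (z * t)) with (fun n => d n * t ^ n); [reflexivity|].
    apply functional_extensionality. intros n. symmetry. apply pFq_term_mul. }
  rewrite <- Ei in HI. destruct HI as [HI1 HI2].
  split; [|split; [exact HI1|]].
  (* Convergence of the inner series is a consequence of that of the left-hand side, through the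
     decay of [d]. *)
  - intros t Ht. destruct (entire_geom d t Hd ltac:(lra)) as [B [_ HBn]].
    exists (Cseries (pFq_term alpha beta (z * t))). apply is_series_Csums.
    apply (geom_series _ B). intros n. rewrite pFq_term_mul. apply HBn. lra.
  - unfold rGammas. rewrite (Cseries_unique _ _ HS), HI2. field. exact HG.
Qed.
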